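(* Let $a,b>0$ and $U=\{(x_1,x_2)\in\mathbb{R}^2:|x_1|<a,\ |x_2|<b\}$. Let $P_1$ and $P_2$ be the plastic components (see context) attached to the sides $x_2=-b$ and $x_1=-a$ of $U$ respectively, and let $\rho$ be the reflection with respect to the bisector $x_2=x_1+a-b$ of $\partial U$ at $(-a,-b)$, i.e. $\rho(x_1,x_2)=(x_2-a+b,\;x_1+a-b)$. If $b<a$, then $\rho(P_2)\subset P_1$.
   Context: Fix $1<q\le 2$, $p=\frac{q}{q-1}\in[2,\infty)$ and $\eta>0$. For $r\ge1$ let $\gamma_r((x_1,x_2))=(|x_1|^r+|x_2|^r)^{1/r}$ on $\mathbb{R}^2$. Write $d_p(x)=\min_{y\in\partial U}\gamma_p(x-y)$; a point $y\in\partial U$ attaining the minimum is a $p$-closest point to $x$ (for the rectangle, $d_p(x)=\min(a-|x_1|,b-|x_2|)$). $u$ is the minimizer of $I[v]=\int_U\frac12|Dv|^2-\eta v\,dx$ over $\{v\in H^1_0(U): \gamma_q(Dv)\le1 \text{ a.e.}\}$ (equivalently over $\{v\in H_0^1(U): v\le d_p \text{ a.e.}\}$). The plastic region is $P=\{x\in U:u(x)=d_p(x)\}$ and the elastic region is $E=U\setminus P$. It is known that each side of $U$ has at most one plastic component attached to it, and by symmetry these components are $$P_1=\{|x_1|\le\alpha,\ -b\le x_2\le -b+\phi(x_1)\},\qquad P_2=\{|x_2|\le\beta,\ -a\le x_1\le -a+\psi(x_2)\},$$ together with the reflection $P_3$ of $P_1$ in the $x_1$-axis and the reflection $P_4$ of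 $P_2$ in the $x_2$-axis. Here $\phi,\psi$ are continuous nonnegative even functions, positive exactly on $(-\alpha,\alpha)$, $(-\beta,\beta)$ respectively. Equivalently, $P_1$ (resp. $P_2$) is the closure in $\mathbb{R}^2$ of the set of $x\in P$ having a $p$-closest point on $\partial U$ lying on the side $x_2=-b$ (resp. $x_1=-a$); it is understood to be empty if there is no such $x$. *)

(* Defs.v *)
From HB Require Import structures.
From mathcomp Require Import all_boot all_order all_algebra.
From mathcomp Require Import all_classical all_reals all_analysis.

Set Implicit Arguments.
Unset Strict Implicit.
Unset Printing Implicit Defensive.

Import Order.TTheory GRing.Theory Num.Theory.
Import numFieldNormedType.Exports.

Local Open Scope classical_set_scope.
Local Open Scope ring_scope.

Definition lebesgue2 (R : realType) :
    {measure set (measurableTypeR R * measurableTypeR R) -> \bar R} :=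
  (@lebesgue_measure R \x @lebesgue_measure R)%E.

(* Intended for r >= 1. *)
Definition gamma (R : realType) (r : R) (x : R * R) : R :=
  (`|x.1| `^ r + `|x.2| `^ r) `^ r^-1.

Definition boundary (T : topologicalType) (A : set T) : set T :=
  closure A `\` interior A.

Definition rectangle (R : realType) (a b : R) : set (R * R) :=
  [set x | `|x.1| < a /\ `|x.2| < b].

(* The infimum is a minimum when U is bounded, open and nonempty, the boundary
   being then compact and nonempty. *)
Definition dist_boundary (R : realType) (p : R) (U : set (R * R))
    (x : R * R) : R :=
  inf [set gamma p (x - y) | y in boundary U].

Definition closest_point (R : realType) (p : R) (U : set (R * R))
    (x y : R * R) : Prop :=
  boundary U y /\ gamma p (x - y) = dist_boundary p U x.

Definition pd1 (R : realType) (f : R * R -> R) (x : R * R) : R :=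
  'D_((1, 0) : R * R) f x.

Definition pd2 (R : realType) (f : R * R -> R) (x : R * R) : R :=
  'D_((0, 1) : R * R) f x.

(* The word s lists the successive partial derivatives, true standing for x_1
   and false for x_2. *)
Definition iter_pd (R : realType) (s : seq bool) (f : R * R -> R) :
    R * R -> R :=
  foldr (fun i g => if i then pd1 g else pd2 g) f s.

(* The derivatives 'D_v are total functions, whence the derivability clauses. *)
Definition smooth (R : realType) (f : R * R -> R) : Prop :=
  forall s : seq bool,
    [/\ continuous (iter_pd s f),
        forall x, derivable (iter_pd s f) x ((1, 0) : R * R) &
        forall x, derivable (iter_pd s f) x ((0, 1) : R * R)].

Definition test_function (R : realType) (U : set (R * R)) (f : R * R -> R) :
    Prop :=
  [/\ smooth f, compact (closure [set x | f x != 0]) &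
      closure [set x | f x != 0] `<=` U].

Definition L2 (R : realType) (U : set (R * R)) (f : R * R -> R) : Prop :=
  measurable_fun U f /\
  (@lebesgue2 R).-integrable U (fun x => (f x ^+ 2)%:E).

Definition weak_gradient (R : realType) (U : set (R * R)) (v : R * R -> R)
    (Dv : R * R -> R * R) : Prop :=
  forall f, test_function U f ->
    (\int[@lebesgue2 R]_(x in U) (v x * pd1 f x) =
      - (\int[@lebesgue2 R]_(x in U) ((Dv x).1 * f x))) /\
    (\int[@lebesgue2 R]_(x in U) (v x * pd2 f x) =
      - (\int[@lebesgue2 R]_(x in U) ((Dv x).2 * f x))).

(* v belongs to H^1(U), with weak gradient Dv (unique up to null sets). *)
Definition H1 (R : realType) (U : set (R * R)) (v : R * R -> R)
    (Dv : R * R -> R * R) : Prop :=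
  [/\ L2 U v, L2 U (fun x => (Dv x).1), L2 U (fun x => (Dv x).2) &
      weak_gradient U v Dv].

(* H^1_0(U) is the closure of the test functions for the H^1 norm. *)
Definition H10 (R : realType) (U : set (R * R)) (v : R * R -> R)
    (Dv : R * R -> R * R) : Prop :=
  H1 U v Dv /\
  forall e : R, 0 < e -> exists2 f, test_function U f &
    (\int[@lebesgue2 R]_(x in U)
      ((v x - f x) ^+ 2 + ((Dv x).1 - pd1 f x) ^+ 2
        + ((Dv x).2 - pd2 f x) ^+ 2)%:E < (e ^+ 2)%:E)%E.

Definition admissible (R : realType) (q : R) (U : set (R * R))
    (v : R * R -> R) (Dv : R * R -> R * R) : Prop :=
  H10 U v Dv /\ {ae @lebesgue2 R, forall x, U x -> gamma q (Dv x) <= 1}.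

Definition energy (R : realType) (eta : R) (U : set (R * R))
    (v : R * R -> R) (Dv : R * R -> R * R) : R :=
  \int[@lebesgue2 R]_(x in U)
    (2^-1 * ((Dv x).1 ^+ 2 + (Dv x).2 ^+ 2) - eta * v x).

Definition minimizer (R : realType) (q eta : R) (U : set (R * R))
    (u : R * R -> R) : Prop :=
  exists2 Du, admissible q U u Du &
    forall v Dv, admissible q U v Dv -> energy eta U u Du <= energy eta U v Dv.

(* u is compared with the distance pointwise: u must be the continuous
   representative of its class. *)
Definition plastic (R : realType) (p : R) (U : set (R * R)) (u : R * R -> R) :
    set (R * R) :=
  [set x | U x /\ u x = dist_boundary p U x].

Definition plastic_component (R : realType) (p : R) (U : set (R * R))
    (u : R * R -> R) (side : set (R * R)) : set (R * R) :=
  closure [set x | plastic p U u x /\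
                   exists2 y, side y & closest_point p U x y].

Definition bottom_side (R : realType) (a b : R) : set (R * R) :=
  [set y | `|y.1| <= a /\ y.2 = - b].

Definition left_side (R : realType) (a b : R) : set (R * R) :=
  [set y | y.1 = - a /\ `|y.2| <= b].

(* Reflection in the line x_2 = x_1 + a - b. *)
Definition rho (R : realType) (a b : R) (x : R * R) : R * R :=
  (x.2 - a + b, x.1 + a - b).

(* Main.v *)
(* Let rho be the reflection, H the half plane x_2 - x_1 > a - b, and let u be
   extended by zero.  Since b < a, rho maps the part of U in H into U.  For
   s = u - u o rho and a smooth theta with 0 <= theta' < 1 vanishing up to d > 0
   and positive beyond, put w = theta(s) on H, w = 0 elsewhere, and
   v = u - w + w o rho.  Where Dv is not Du it is a convex combination of Du and
   of the reflected gradient of u, so v satisfies the constraint, and pairing x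
   with rho x shows that the energy drops by the integral over H of
   theta'(s) (1 - theta'(s)) |Ds|^2.  Minimality gives Dw = 0, hence w = 0 and
   s <= d for every d > 0: u <= u o rho on U and H.  At a point x of the plastic
   region whose closest point is on the left side, dist(x) = x_1 + a is also the
   distance from rho x to the bottom side, and
   dist(x) = u(x) <= u(rho x) <= (rho x)_2 + b = dist(x),
   where the last inequality only uses |D_2 u| <= 1 and the zero boundary values.
   H^1_0 being a closure of test functions, every competitor comes with its
   approximating test functions, obtained by applying the same operations to
   those of u; this is why all truncations are smooth.  The argument needs
   u >= 0, which follows by comparing u with a smooth truncation from below. *)

Require Import Defs.
From mathcomp Require Import all_boot all_order all_algebra.
From mathcomp Require Import all_classical all_reals all_analysis.
From mathcomp Require Import measurable_realfun ring lra.
Set Implicit Arguments.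
Unset Strict Implicit.
Unset Printing Implicit Defensive.
Import Order.TTheory GRing.Theory Num.Theory.
Import numFieldNormedType.Exports.
Local Open Scope classical_set_scope.
Local Open Scope ring_scope.

(** * Smooth truncations *)

(** The profile theta has slope strictly below 1 on purpose. With slope 1 the competitor would
    merely exchange u and u o rho where s > 0, the energy would stay the same and uniqueness of the
    minimizer would have to be invoked; the factor 1 - theta' makes the loss visible.

    Truncation is not Lipschitz for the H^1 norm in general. Here it is, because the constraint
    bounds |D_i u| by 1: in c d - c' d' = c' (d - d') + (c - c') d the difference of slopes
    multiplies the bounded gradient, never that of a test function. So each operation multiplies the
    squared error by a constant, pointwise, up to a reflected term.

    The threshold d is the room that keeps the cut functions smooth: s vanishes on the bisector, so
    its truncation vanishes around it. Nonnegativity serves the boundary: where u = 0 one has s <=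
    0, hence w = 0. The approximating test functions may be negative; they are first truncated from
    below so as to be >= -d, which the threshold absorbs, and u >= 0 makes this truncation invisible
    in the limit. *)

Lemma continuous_derivable1 (R : realType) (f g : R -> R) :
  (forall x : R, is_derive x 1 f (g x)) -> continuous f.
Proof.
move=> df x; apply: differentiable_continuous.
by apply/derivable1_diffP; case: (df x).
Qed.

Lemma is_derive_bounded_lipschitz (R : realType) (f g : R -> R) (c : R) :
  (forall x : R, is_derive x 1 f (g x)) -> (forall x, `|g x| <= c) ->
  forall x y, `|f x - f y| <= c * `|x - y|.
Proof.
move=> df gc.
have H x y : x <= y -> `|f y - f x| <= c * `|y - x|.
  move=> xy.
  have [|z _ ->] := @MVT_segment R f g x y xy (fun z _ => df z).
    by apply: continuous_subspaceT; exact: continuous_derivable1 df.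
  by rewrite normrM ler_wpM2r.
move=> x y; have [xy|/ltW yx] := leP x y; last exact: H.
by rewrite distrC (distrC x); exact: H.
Qed.

(** * The flat functions t^(-m) e^(-1/t) *)

Section flat.
Variable R : realType.
Implicit Types (m : nat) (t : R).

(* The span of these functions is closed under differentiation. *)
Definition flat m t : R := if 0 < t then t ^- m * expR (- t^-1) else 0.

Lemma flat_le0 m t : t <= 0 -> flat m t = 0.
Proof. by rewrite /flat ltNge => ->. Qed.

Lemma flat_gt0 m t : 0 < t -> flat m t = t ^- m * expR (- t^-1).
Proof. by rewrite /flat => ->. Qed.

Lemma flat_ge0 m t : 0 <= flat m t.
Proof.
rewrite /flat; case: ifPn => // t0.
by rewrite mulr_ge0 ?expR_ge0// invr_ge0 exprn_ge0 ?ltW.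
Qed.

Lemma flatS m t : flat m t = t * flat m.+1 t.
Proof.
have [t0|t0] := ltP 0 t; last by rewrite !flat_le0 ?mulr0.
rewrite !flat_gt0// exprS invfM !mulrA divff ?mul1r ?gt_eqF//.
Qed.

(** With x = 1/(m t) the left side is (m x e^(-x))^m, and x e^(-x) <= 1 because e^x >= 1 + x. For m
    = 0 the bound is 0^0 = 1. *)
Lemma flat_bounded m t : flat m t <= m%:R ^+ m.
Proof.
have [t0|t0] := ltP 0 t; last by rewrite flat_le0 ?exprn_ge0.
rewrite flat_gt0//; case: m => [|m].
  by rewrite !expr0 invr1 mul1r -[leRHS]expR0 ler_expR oppr_le0 invr_ge0 ltW.
set x := t^-1 / m.+1%:R.
have x0 : 0 < x by rewrite divr_gt0 ?invr_gt0.
have tx : t^-1 = x * m.+1%:R by rewrite mulfVK.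
rewrite -exprVn tx -mulNr expRM_natr -exprMn.
have H : x * m.+1%:R * expR (- x) <= m.+1%:R; last first.
  apply: lerXn2r H; rewrite nnegrE; last exact: ler0n.
  by apply: mulr_ge0; [apply: mulr_ge0 => //; exact: ltW|exact: expR_ge0].
rewrite mulrAC -[leRHS]mul1r ler_wpM2r// expRN ler_pdivrMr ?expR_gt0// mul1r.
by have := expR_ge1Dx x; lra.
Qed.

Lemma flat_le_dist m t : `|flat m t| <= (m.+1)%:R ^+ m.+1 * `|t|.
Proof.
by rewrite flatS normrM mulrC ler_wpM2r// ger0_norm ?flat_ge0 ?flat_bounded.
Qed.

Lemma flat_cvg0 m : flat m x @[x --> (0:R)] --> (0 : R).
Proof.
apply/cvgrPdist_le => e e0; near=> x.
rewrite sub0r normrN (le_trans (flat_le_dist _ _))//.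
rewrite -ler_pdivlMl ?exprn_gt0//.
near: x; have := @nbhs0_le R R (((m.+1)%:R ^+ m.+1)^-1 * e).
by apply; rewrite mulr_gt0 ?invr_gt0 ?exprn_gt0.
Unshelve. all: by end_near.
Qed.

Lemma is_derive_flat m t :
  is_derive t 1 (flat m) (flat m.+2 t - m%:R * flat m.+1 t).
Proof.
have [t0|t0|->] := ltgtP t 0.
- rewrite !flat_le0 ?ltW// mulr0 subr0.
  apply: (@near_eq_is_derive _ _ _ (cst 0)).
  by near=> x; rewrite flat_le0// ltW//; near: x; exact: lt_nbhsl.
- rewrite !flat_gt0//.
  have dV : is_derive t 1 (fun x : R => x^-1) (- t ^- 2).
    have := @is_deriveV R id t 1 1 (lt0r_neq0 t0) (is_derive_id _ _).
    by rewrite /GRing.scale/= mulr1.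
  have dP : is_derive t 1 (fun x : R => x ^- m) (- m%:R * t ^- m.+1).
    have -> : (fun x : R => x ^- m) = (fun x : R => x^-1) ^+ m.
      by apply/funext => x; rewrite fctE exprVn.
    apply: is_derive_eq => //; rewrite /GRing.scale/= exprVn -mulr_natl.
    case: m => [|m]; first by rewrite !mul0r oppr0 mul0r.
    rewrite /= !exprS; field; rewrite gt_eqF ?exprn_gt0 ?gt_eqF//.
  have dE : is_derive t 1 (fun x : R => expR (- x^-1)) (expR (- t^-1) * t ^- 2).
    apply: (@is_derive1_comp R expR (fun x => - x^-1)).
    by apply: is_derive_eq; rewrite opprK.
  have dF : is_derive t 1 (fun x : R => x ^- m * expR (- x^-1))
      (t ^- m.+2 * expR (- t^-1) - m%:R * (t ^- m.+1 * expR (- t^-1))).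
    apply: is_derive_eq.
    rewrite /GRing.scale/= -!exprVn !exprS; ring.
  apply: near_eq_is_derive dF.
  by near=> x; rewrite flat_gt0//; near: x; exact: lt_nbhsr.
- rewrite !flat_le0// mulr0 subr0.
  (* At 0 the difference quotient of [flat m] is [flat m.+1], which tends to 0. *)
  have H : h^-1 *: ((flat m \o shift 0) (h *: (1 : R)) - flat m 0)
             @[h --> (0:R)^'] --> (0 : R).
    apply: (@cvg_trans _ (flat m.+1 x @[x --> (0:R)^'])).
      apply: near_eq_cvg; near=> h.
      rewrite /= addr0 (flat_le0 _ (lexx 0)) subr0 /GRing.scale/= mulr1.
      rewrite (flatS m) mulrA mulVf ?mul1r//.
      by near: h; exact: nbhs_dnbhs_neq.
    by apply: cvg_within_filter; exact: flat_cvg0.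
  by apply: DeriveDef; [apply/cvg_ex; exists 0|exact/cvg_lim].
Unshelve. all: by end_near.
Qed.
End flat.

(** * Repeated differentiability on the line and the ramp *)

Section profile.
Variable R : realType.
Implicit Types (m n : nat) (t : R).

(** Each derivative is an existential witness rather than a value of the total derivation operator,
    so that the closure properties follow by induction on [n]. *)
Fixpoint Cn n (f : R -> R) : Prop :=
  continuous f /\
  if n is n'.+1 then
    exists2 g, (forall t : R, is_derive t 1 f (g t)) & Cn n' g
  else True.

Lemma Cn_continuous n f : Cn n f -> continuous f.
Proof. by case: n => [|n] []. Qed.

Lemma Cn_derive n f g :
  (forall t : R, is_derive t 1 f (g t)) -> Cn n g -> Cn n.+1 f.
Proof.
by move=> df cg; split; [exact: continuous_derivable1 df|exists g].
Qed.

Lemma CnD n f g : Cn n f -> Cn n g -> Cn n (fun t => f t + g t).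
Proof.
elim: n f g => [|n IH] f g.
  by move=> [cf _] [cg _]; split => // t; apply: cvgD; [exact: cf|exact: cg].
move=> [_ [f' df cf']] [_ [g' dg cg']].
by apply: (@Cn_derive _ _ (fun t => f' t + g' t)); exact: IH.
Qed.

Lemma CnZ n c f : Cn n f -> Cn n (fun t => c * f t).
Proof.
elim: n c f => [|n IH] c f.
  by move=> [cf _]; split => // t; apply: cvgMr; exact: cf.
move=> [_ [f' df cf']].
by apply: (@Cn_derive _ _ (fun t => c * f' t)); exact: IH.
Qed.

Lemma Cn_affine n c e f : Cn n f -> Cn n (fun t => f (c * t + e)).
Proof.
elim: n f => [|n IH] f.
  move=> [cf _]; split => // t; apply: (@continuous_comp _ _ _ (fun t => c * t + e)).
    by apply: cvgD; [apply: cvgMr; exact: cvg_id|exact: cvg_cst].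
  exact: cf.
move=> [_ [f' df cf']].
apply: (@Cn_derive _ _ (fun t => c * f' (c * t + e))) => [t|].
  rewrite mulrC; apply: (@is_derive1_comp R f (fun t => c * t + e)).
  by apply: is_derive_eq; rewrite addr0 /GRing.scale/= mulr1.
exact/CnZ/IH.
Qed.

Lemma Cn_id n : Cn n (fun t : R => t).
Proof.
case: n => [|n]; first by split => // t; exact: cvg_id.
apply: (@Cn_derive _ _ (fun=> 1)).
elim: n 1 => [|n IH] c; first by split => // t; exact: cvg_cst.
by apply: (@Cn_derive _ _ (fun=> 0)); exact: IH.
Qed.

Lemma Cn_flat n m : Cn n (@flat R m).
Proof.
elim: n m => [|n IH] m.
  by split => //; apply: continuous_derivable1; exact: is_derive_flat.
apply: Cn_derive; first exact: is_derive_flat.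
rewrite (_ : (fun _ => _) = (fun t => flat m.+2 t + (- m%:R) * flat m.+1 t)).
  by apply: CnD => //; exact: CnZ.
by apply/funext => t; rewrite mulNr.
Qed.

(* t e^(-1/t), a smooth substitute for the positive part. *)
Definition ramp t : R := t * flat 0 t.
Definition ramp' t : R := flat 0 t + flat 1 t.

Lemma is_derive_ramp t : is_derive t 1 ramp (ramp' t).
Proof.
have H := @is_derive_flat R 0 t.
apply: (@is_derive_eq _ _ _ _ _ _ _ _ (is_deriveM (is_derive_id t 1) H)).
by rewrite /ramp' mul0r subr0 /GRing.scale/= mulr1 addrC (flatS 1).
Qed.

Lemma Cn_ramp n : Cn n ramp.
Proof.
case: n => [|n].
  by split => //; apply: continuous_derivable1; exact: is_derive_ramp.
apply: Cn_derive; first exact: is_derive_ramp.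
by apply: CnD; exact: Cn_flat.
Qed.

Lemma ramp'_ge0 t : 0 <= ramp' t.
Proof. by rewrite addr_ge0 ?flat_ge0. Qed.

(** With s = 1/t this is 1 + s < e^s. The strictness is what later makes the energy drop. *)
Lemma ramp'_lt1 t : ramp' t < 1.
Proof.
have [t0|t0] := ltP 0 t; last by rewrite /ramp' !flat_le0 ?addr0.
rewrite /ramp' !flat_gt0// expr0 invr1 expr1 -mulrDl expRN.
rewrite ltr_pdivrMr ?expR_gt0// mul1r expR_gt1Dx// invr_neq0// gt_eqF//.
Qed.

Lemma ramp_le0 t : t <= 0 -> ramp t = 0.
Proof. by move=> t0; rewrite /ramp flat_le0 ?mulr0. Qed.

Lemma ramp'_le0 t : t <= 0 -> ramp' t = 0.
Proof. by move=> t0; rewrite /ramp' !flat_le0 ?addr0. Qed.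

Lemma ramp_gt0 t : 0 < t -> 0 < ramp t.
Proof.
move=> t0; rewrite /ramp mulr_gt0// flat_gt0// expr0 invr1 mul1r.
exact: expR_gt0.
Qed.

Lemma ramp_ge0 t : 0 <= ramp t.
Proof.
by have [/ramp_gt0/ltW//|t0] := ltP 0 t; rewrite ramp_le0.
Qed.

(** From e^(-1/t) >= 1 - 1/t when t > 0: the ramp stays within 1 of the positive part. *)
Lemma ramp_ge t : t - 1 <= ramp t.
Proof.
have [t0|t0] := ltP 0 t; last by rewrite ramp_le0//; lra.
rewrite /ramp flat_gt0// expr0 invr1 mul1r.
have := expR_ge1Dx (- t^-1); rewrite -(ler_pM2l t0) mulrDr mulr1 mulrN divff//.
by rewrite gt_eqF.
Qed.

Lemma ramp_lipschitz s t : `|ramp s - ramp t| <= `|s - t|.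
Proof.
rewrite -[leRHS]mul1r; apply: (is_derive_bounded_lipschitz is_derive_ramp) => x.
by rewrite ger0_norm ?ramp'_ge0// ltW// ramp'_lt1.
Qed.

(** The derivatives of [flat 0] and [flat 1] telescope to [flat 3], whose bound is 3^3 = 27. *)
Lemma ramp'_lipschitz s t : `|ramp' s - ramp' t| <= 27 * `|s - t|.
Proof.
apply: (@is_derive_bounded_lipschitz R _ (flat 3)) => x.
  have H0 := @is_derive_flat R 0 x; have H1 := @is_derive_flat R 1 x.
  apply: (@is_derive_eq _ _ _ _ _ _ _ _ (is_deriveD H0 H1)).
  by rewrite mul0r subr0 mul1r addrC subrK.
by rewrite ger0_norm ?flat_ge0//; apply: (le_trans (flat_bounded _ _)); lra.
Qed.

End profile.

Section trunc.
Variables (R : realType) (d : R).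
Hypothesis d0 : 0 < d.
Implicit Types (n : nat) (s t : R).

(** Rescaling brings the gap to the positive part down to [d] and keeps the slope in [0, 1); the
    price is the Lipschitz constant 27/d of the slope. *)
Definition trunc t : R := d * ramp (d^-1 * t).
Definition trunc' t : R := ramp' (d^-1 * t).

Lemma is_derive_trunc t : is_derive t 1 trunc (trunc' t).
Proof.
have H : is_derive t 1 (fun x : R => d^-1 * x) d^-1.
  by apply: is_derive_eq; rewrite /GRing.scale/= mulr1.
have := is_deriveZ d (is_derive1_comp (is_derive_ramp (d^-1 * t)) H).
by move/is_derive_eq; apply; rewrite /GRing.scale/= mulrC mulfVK ?gt_eqF.
Qed.

Lemma Cn_trunc n : Cn n trunc.
Proof.
apply: CnZ; rewrite (_ : (fun _ => _) = (fun t => ramp (d^-1 * t + 0))).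
  by apply: Cn_affine; exact: Cn_ramp.
by apply/funext => t; rewrite addr0.
Qed.

Lemma trunc'_ge0 t : 0 <= trunc' t. Proof. exact: ramp'_ge0. Qed.

Lemma trunc'_lt1 t : trunc' t < 1. Proof. exact: ramp'_lt1. Qed.

Lemma trunc_le0 t : t <= 0 -> trunc t = 0.
Proof. by move=> t0; rewrite /trunc ramp_le0 ?mulr0// pmulr_rle0 ?invr_gt0. Qed.

Lemma trunc'_le0 t : t <= 0 -> trunc' t = 0.
Proof. by move=> t0; rewrite /trunc' ramp'_le0// pmulr_rle0 ?invr_gt0. Qed.

Lemma trunc_gt0 t : 0 < t -> 0 < trunc t.
Proof. by move=> t0; rewrite mulr_gt0// ramp_gt0// mulr_gt0 ?invr_gt0. Qed.

Lemma trunc_ge0 t : 0 <= trunc t.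
Proof. by rewrite mulr_ge0 ?ramp_ge0 ?ltW. Qed.

Lemma trunc_ge t : t - d <= trunc t.
Proof.
have := ramp_ge (d^-1 * t); rewrite -(ler_pM2l d0) mulrBr mulVKf ?gt_eqF//.
by rewrite mulr1.
Qed.

Lemma trunc_lipschitz s t : `|trunc s - trunc t| <= `|s - t|.
Proof.
rewrite /trunc -mulrBr normrM gtr0_norm// mulrC -ler_pdivlMr//.
apply: (le_trans (ramp_lipschitz _ _)).
by rewrite -mulrBr normrM gtr0_norm ?invr_gt0// mulrC.
Qed.

Lemma trunc'_lipschitz s t : `|trunc' s - trunc' t| <= 27 / d * `|s - t|.
Proof.
apply: (le_trans (ramp'_lipschitz _ _)).
by rewrite -mulrBr normrM gtr0_norm ?invr_gt0// mulrA.
Qed.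

Lemma continuous_trunc' : continuous trunc'.
Proof.
have [_ [h dh _]] : Cn 1 (@ramp' R).
  by apply: CnD; exact: Cn_flat.
move=> t; apply: (@continuous_comp _ _ _ (fun t : R => d^-1 * t)).
  by apply: cvgMr; exact: cvg_id.
exact: (continuous_derivable1 dh).
Qed.

End trunc.

(** * Smooth functions on the plane *)

Section smooth_plane.
Variable R : realType.
Implicit Types (n : nat) (f g : R * R -> R) (x v : R * R).

Let e1 : R * R := (1, 0).
Let e2 : R * R := (0, 1).

(** The two difference quotients coincide; this carries the one-variable chain rule over to
    directional derivatives. *)
Lemma is_derive_line (V : normedModType R) (f : V -> R) (x v : V) (d : R) :
  is_derive x v f d <-> is_derive (0 : R) 1 (fun h : R => f (h *: v + x)) d.
Proof.
have E : (fun h : R => h^-1 *: ((f \o shift x) (h *: v) - f x)) =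
    (fun h : R => h^-1 *: (((fun h : R => f (h *: v + x)) \o shift 0) (h *: (1 : R))
                  - (fun h : R => f (h *: v + x)) 0)).
  apply/funext => h /=.
  by rewrite scale0r add0r addr0 /GRing.scale/= mulr1.
split=> -[D1 D2]; apply: DeriveDef.
- by move: D1; rewrite /derivable E.
- by move: D2; rewrite /derive E.
- by move: D1; rewrite /derivable -E.
- by move: D2; rewrite /derive -E.
Qed.

Lemma is_derive_comp_dir (phi : R -> R) f x v (p d : R) :
  is_derive (f x) 1 phi p -> is_derive x v f d ->
  is_derive x v (phi \o f) (p * d).
Proof.
move=> dphi /is_derive_line df; apply/is_derive_line.
apply: (@is_derive1_comp R phi (fun h => f (h *: v + x))) => //.
by rewrite scale0r add0r.
Qed.

Lemma is_derive_affine (c k : R) : is_derive (0 : R) 1 (fun h : R => h *: c + k) c.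
Proof.
have -> : (fun h : R => h *: c + k) = (fun h : R => c * h + k).
  by apply/funext => h; rewrite /GRing.scale/= mulrC.
by apply: is_derive_eq; rewrite addr0 /GRing.scale/= mulr1.
Qed.

(** The plane counterpart of [Cn]; [smoothP] links it with iterated partial derivatives. *)
Fixpoint Sn n f : Prop :=
  continuous f /\
  if n is n'.+1 then
    exists g1 g2, [/\ forall x, is_derive x e1 f (g1 x),
      forall x, is_derive x e2 f (g2 x), Sn n' g1 & Sn n' g2]
  else True.

Lemma smoothP f : smooth f <-> forall n, Sn n f.
Proof.
split=> [sf n|sf s].
  elim: n f sf => [|n IH] f sf; have [cf d1 d2] := sf [::]; split => //.
  exists (pd1 f), (pd2 f); split => [x|x||].
  - by apply: DeriveDef => //; exact: d1.
  - by apply: DeriveDef => //; exact: d2.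
  - by apply: IH => s; have := sf (rcons s true); rewrite /iter_pd foldr_rcons.
  - by apply: IH => s; have := sf (rcons s false); rewrite /iter_pd foldr_rcons.
elim/last_ind: s f sf => [|s i IH] f sf.
  have [cf [g1 [g2 [d1 d2 _ _]]]] := sf 1%N.
  by split => // x.
rewrite /iter_pd foldr_rcons; apply: IH => n.
have [cf [g1 [g2 [d1 d2 s1 s2]]]] := sf n.+1.
case: i.
  by have -> : pd1 f = g1 by apply/funext => x; case: (d1 x).
by have -> : pd2 f = g2 by apply/funext => x; case: (d2 x).
Qed.

Lemma SnW n f : Sn n.+1 f -> Sn n f.
Proof.
elim: n f => [|n IH] f; first by case.
move=> [cf [g1 [g2 [d1 d2 s1 s2]]]]; split => //.
by exists g1, g2; split => //; exact: IH.
Qed.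

Lemma Sn_cst n c : Sn n (fun=> c).
Proof.
elim: n c => [|n IH] c; first by split => // x; exact: cvg_cst.
split => [x|]; first exact: cvg_cst.
by exists (fun=> 0), (fun=> 0); split => // x; exact: is_derive_cst.
Qed.

Lemma SnD n f g : Sn n f -> Sn n g -> Sn n (fun x => f x + g x).
Proof.
elim: n f g => [|n IH] f g.
  by move=> [cf _] [cg _]; split => // x; apply: cvgD; [exact: cf|exact: cg].
move=> [cf [f1 [f2 [d1 d2 s1 s2]]]] [cg [g1 [g2 [h1 h2 t1 t2]]]].
split => [x|]; first by apply: cvgD; [exact: cf|exact: cg].
exists (fun x => f1 x + g1 x), (fun x => f2 x + g2 x).
split => [x|x||]; [exact: is_deriveD|exact: is_deriveD|exact: IH|exact: IH].
Qed.

Lemma SnM n f g : Sn n f -> Sn n g -> Sn n (fun x => f x * g x).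
Proof.
elim: n f g => [|n IH] f g.
  by move=> [cf _] [cg _]; split => // x; apply: cvgM; [exact: cf|exact: cg].
move=> sf sg; move: (sf) (sg).
move=> [cf [f1 [f2 [d1 d2 s1 s2]]]] [cg [g1 [g2 [h1 h2 t1 t2]]]].
split => [x|]; first by apply: cvgM; [exact: cf|exact: cg].
exists (fun x => f x * g1 x + g x * f1 x), (fun x => f x * g2 x + g x * f2 x).
split => [x|x||]; [exact: is_deriveM|exact: is_deriveM| |].
- by apply: SnD; apply: IH => //; exact: SnW.
- by apply: SnD; apply: IH => //; exact: SnW.
Qed.

Lemma SnN n f : Sn n f -> Sn n (fun x => - f x).
Proof.
move=> sf; rewrite (_ : (fun _ => _) = (fun x => -1 * f x)).
  by apply: SnM => //; exact: Sn_cst.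
by apply/funext => x; rewrite mulN1r.
Qed.

Lemma Sn_snd n : Sn n (snd : R * R -> R).
Proof.
have cf : continuous (snd : R * R -> R) by move=> x; exact: cvg_snd.
case: n => [|n]; first by split.
split => //; exists (fun=> 0), (fun=> 1).
split => [x|x||]; [| |exact: Sn_cst|exact: Sn_cst]; apply/is_derive_line.
- exact: is_derive_affine.
- exact: is_derive_affine.
Qed.

Lemma Sn_comp n (phi : R -> R) f : Cn n phi -> Sn n f -> Sn n (phi \o f).
Proof.
elim: n phi f => [|n IH] phi f.
  move=> [cphi _] [cf _]; split => // x.
  by apply: continuous_comp; [exact: cf|exact: cphi].
move=> [cphi [psi dphi cpsi]] sf; move: (sf) => [cf [f1 [f2 [d1 d2 s1 s2]]]].
split => [x|]; first by apply: continuous_comp; [exact: cf|exact: cphi].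
exists (fun x => (psi \o f) x * f1 x), (fun x => (psi \o f) x * f2 x).
split => [x|x||]; [exact: is_derive_comp_dir|exact: is_derive_comp_dir| |].
- by apply: SnM => //; apply: IH => //; exact: SnW.
- by apply: SnM => //; apply: IH => //; exact: SnW.
Qed.

Lemma rho_continuous (a b : R) : continuous (rho a b).
Proof.
move=> x; apply: (@cvg_pair _ _ _ _ (nbhs (x.2 - a + b)) (nbhs (x.1 + a - b))).
- apply: cvgD; last exact: cvg_cst.
  by apply: cvgB; [exact: cvg_snd|exact: cvg_cst].
- apply: cvgB; last exact: cvg_cst.
  by apply: cvgD; [exact: cvg_fst|exact: cvg_cst].
Qed.

(** The linear part of [rho] exchanges the coordinates, so it turns the direction [v] into (v_2,
    v_1). *)
Lemma is_derive_rho (a b : R) f (g : R * R -> R) x v :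
  (forall y, is_derive y (v.2, v.1) f (g y)) ->
  is_derive x v (f \o rho a b) (g (rho a b x)).
Proof.
move=> df; apply/is_derive_line.
have /is_derive_line := df (rho a b x); congr is_derive.
apply/funext => h; congr f; rewrite /rho/=; congr pair => /=.
  by rewrite !addrA.
by rewrite !addrA.
Qed.

Lemma Sn_rho n (a b : R) f : Sn n f -> Sn n (f \o rho a b).
Proof.
elim: n f => [|n IH] f.
  move=> [cf _]; split => // x.
  by apply: continuous_comp; [exact: rho_continuous|exact: cf].
move=> [cf [f1 [f2 [d1 d2 s1 s2]]]].
split => [x|]; first by apply: continuous_comp; [exact: rho_continuous|exact: cf].
exists (f2 \o rho a b), (f1 \o rho a b).
by split => [x|x||]; [exact: is_derive_rho|exact: is_derive_rho|exact: IH|exact: IH].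
Qed.

(* Condition under which cutting f off outside A creates no singularity. *)
Definition clean_cut (A : set (R * R)) f := forall x,
  [\/ \forall y \near x, A y, \forall y \near x, ~ A y |
      \forall y \near x, f y = 0].

Lemma clean_cut_near A f x : clean_cut A f ->
  (\forall y \near x, (f \_ A) y = f y) \/ (\forall y \near x, (f \_ A) y = 0).
Proof.
move=> /(_ x)[nA|nA|f0]; [left|right|right].
- by apply: filterS nA => y Ay; rewrite patchE mem_set.
- by apply: filterS nA => y Ay; rewrite patchE memNset.
- by apply: filterS f0 => y fy; rewrite patchE; case: ifP.
Qed.

Lemma clean_cut_continuous A f :
  clean_cut A f -> continuous f -> continuous (f \_ A).
Proof.
move=> cA cf x; have [E|E] := clean_cut_near x cA.
  rewrite /continuous_at (nbhs_singleton E); apply: cvg_trans (cf x).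
  by apply: near_eq_cvg; apply: filterS E => y ->.
rewrite /continuous_at (nbhs_singleton E); apply: (@cvg_trans _ (cst (0 : R) y @[y --> x])); last exact: (@cst_continuous (R * R)%type R 0 x).
by apply: near_eq_cvg; apply: filterS E => y ->.
Qed.

Lemma clean_cut_is_derive A f g x v : clean_cut A f ->
  (forall y, is_derive y v f (g y)) ->
  is_derive x v (f \_ A) ((g \_ A) x).
Proof.
move=> cA df; case: (cA x) => [nA|nA|f0].
- rewrite patchE mem_set; last exact: nbhs_singleton nA.
  apply: near_eq_is_derive (df x).
  by apply: filterS nA => y Ay; rewrite patchE mem_set.
- rewrite patchE memNset; last exact: nbhs_singleton nA.
  apply: (@near_eq_is_derive _ _ _ (cst 0)).
  by apply: filterS nA => y Ay; rewrite patchE memNset.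
(* Where f vanishes around x so does its derivative, and cutting it off or not gives the same value
   0. *)
- have gx : g x = 0.
    have [_ <-] := df x; rewrite (near_eq_derive (g := cst 0))//.
    exact: derive_cst.
  rewrite patchE gx if_same.
  apply: (@near_eq_is_derive _ _ _ (cst 0)).
  by apply: filterS f0 => y fy; rewrite patchE fy if_same.
Qed.

Lemma clean_cut_deriv A f g v : clean_cut A f ->
  (forall y, is_derive y v f (g y)) -> clean_cut A g.
Proof.
move=> cA df x; case: (cA x) => [?|?|f0]; [exact: Or31|exact: Or32|apply: Or33].
move/nbhs_interior: f0; apply: filterS => y fy.
have [_ <-] := df y.
rewrite (near_eq_derive (g := cst 0))//; exact: derive_cst.
Qed.

Lemma Sn_patch n A f : clean_cut A f -> Sn n f -> Sn n (f \_ A).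
Proof.
elim: n f => [|n IH] f cA.
  by move=> [cf _]; split => //; exact: clean_cut_continuous.
move=> [cf [f1 [f2 [d1 d2 s1 s2]]]].
split; first exact: clean_cut_continuous.
exists (f1 \_ A), (f2 \_ A); split => [x|x||].
- exact: clean_cut_is_derive.
- exact: clean_cut_is_derive.
- by apply: IH s1; exact: clean_cut_deriv d1.
- by apply: IH s2; exact: clean_cut_deriv d2.
Qed.

End smooth_plane.

(** * Lebesgue measure on the plane *)

Section plane_measure.
Variable R : realType.
Local Notation mu := (@lebesgue2 R).
Implicit Types (A B : set (R * R)) (f g : R * R -> R) (x : R * R).

Lemma lebesgue_measure_shift (c : R) (A : set R) : measurable A ->
  lebesgue_measure ((fun t : R => t + c) @^-1` A) = lebesgue_measure A.
Proof.
move=> mA; apply/esym.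
have mf : measurable_fun setT ((fun t : R => t + c) : measurableTypeR R -> measurableTypeR R).
  exact: measurable_funD.
apply: (@lebesgue_measure_unique R (pushforward lebesgue_measure
   ((fun t : R => t + c) : measurableTypeR R -> measurableTypeR R))) => //= _ [[r s]] _ <-.
rewrite /pushforward.
rewrite (_ : _ @^-1` _ = [set` `]r - c, s - c]]); last first.
  by apply/seteqP; split => t /=; rewrite !in_itv/= ltrBlDr lerBrDr.
rewrite !lebesgue_measure_itv/= !lte_fin ltrD2r; case: ifP => // _.
by rewrite -!EFinD opprB addrA subrK.
Qed.

Lemma measurable_rho (a b : R) : measurable_fun [set: R * R] (rho a b).
Proof.
apply: measurable_fun_pair.
- by apply: measurable_funD => //; apply: measurable_funB.
- by apply: measurable_funB => //; apply: measurable_funD.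
Qed.

(** [rho] composes a translation with the exchange of coordinates. On products of measurable sets
    this is translation invariance in each factor, and a product measure is determined by its values
    there. *)
Lemma lebesgue2_rho (a b : R) A : measurable A ->
  mu (rho a b @^-1` A) = mu A.
Proof.
move=> mA; apply/esym.
have mr := measurable_rho a b.
pose nu : {measure set (measurableTypeR R * measurableTypeR R) -> \bar R} :=
  pushforward mu (rho a b : _ -> measurableTypeR R * measurableTypeR R)%type.
apply: (@product_measure_unique _ _ (measurableTypeR R) (measurableTypeR R) R
  lebesgue_measure lebesgue_measure (nu mr) _ A mA) => //= B C mB mC.
rewrite /pushforward (_ : _ @^-1` _ =
  ((fun t : R => t + (a - b)) @^-1` C) `*` ((fun t : R => t + (b - a)) @^-1` B)); last first.
  by apply/seteqP; split => -[s t] /=; rewrite /rho/= -!addrA (addrC b) => -[].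
rewrite /lebesgue2 product_measure1E/= ?lebesgue_measure_shift//.
- by rewrite muleC.
- by rewrite -[X in measurable X]setTI; apply: measurable_funD.
- by rewrite -[X in measurable X]setTI; apply: measurable_funD.
Qed.

Lemma ge0_integral_rho (a b : R) (f : R * R -> \bar R) :
  measurable_fun setT f -> (forall x, 0 <= f x)%E ->
  (\int[mu]_x f (rho a b x) = \int[mu]_x f x)%E.
Proof.
move=> mf f0.
have mr := measurable_rho a b.
pose nu : {measure set (measurableTypeR R * measurableTypeR R) -> \bar R} :=
  pushforward mu (rho a b : _ -> measurableTypeR R * measurableTypeR R)%type.
transitivity (\int[nu mr]_y f y)%E; last first.
  by apply: eq_measure_integral => //= A mA _; exact: lebesgue2_rho.
by rewrite /nu/= ge0_integral_pushforward.
Qed.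

(** The sigma-algebra is the product one, so an open set is written as the countable union of the
    rational boxes that it contains. *)
Lemma open_measurable2 A : open A -> measurable A.
Proof.
move=> oA.
pose Q (q : (rat * rat) * (rat * rat)) : set (R * R) :=
  [set` `]ratr q.1.1, ratr q.1.2[] `*` [set` `]ratr q.2.1, ratr q.2.2[].
pose F q : set (R * R) := if `[< Q q `<=` A >] then Q q else set0.
have -> : A = \bigcup_q F q.
  apply/seteqP; split => [[x1 x2] Ax|x [q _]]; last first.
    by rewrite /F; case: asboolP => // H /H.
  have := open_nbhs_nbhs (conj oA Ax).
  move=> [[B C] [/= nB nC] BC].
  have {nB} /nbhs_ballP[e /= e0 eB] := nB.
  have {nC} /nbhs_ballP[h /= h0 hC] := nC.
  have [q1] := @rat_in_itvoo R (x1 - e) x1 ltac:(lra).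
  have [q2] := @rat_in_itvoo R x1 (x1 + e) ltac:(lra).
  have [r1] := @rat_in_itvoo R (x2 - h) x2 ltac:(lra).
  have [r2] := @rat_in_itvoo R x2 (x2 + h) ltac:(lra).
  rewrite !in_itv/= => /andP[? ?] /andP[? ?] /andP[? ?] /andP[? ?].
  exists ((q1, q2), (r1, r2)) => //; rewrite /F asboolT.
    by rewrite /Q; split => /=; rewrite in_itv/=; apply/andP; split.
  move=> [y1 y2] /= [/=]; rewrite !in_itv/= => /andP[? ?] /andP[? ?].
  apply: BC; split => /=; [apply: eB|apply: hC]; rewrite /ball/= ltr_norml; lra.
apply: countable_bigcupT_measurable => // q.
by rewrite /F; case: asboolP => // _; apply: measurableX.
Qed.

Lemma continuous_measurable2 f : continuous f -> measurable_fun setT f.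
Proof.
move=> cf; apply: (measurability (@RGenOpens.G R)); first exact: RGenOpens.measurableE.
move=> _ [_ [s [t ->]] <-]; rewrite setTI.
apply: open_measurable2; apply: open_comp => //; exact: interval_open.
Qed.

Lemma lebesgue2X (B C : set R) : measurable B -> measurable C ->
  mu (B `*` C) = (lebesgue_measure B * lebesgue_measure C)%E.
Proof.
move=> mB mC.
exact: (@product_measure1E _ _ (measurableTypeR R) (measurableTypeR R) R
  lebesgue_measure lebesgue_measure B C mB mC).
Qed.

Lemma lebesgue2_rectangle (a b : R) : (mu (rectangle a b) < +oo)%E.
Proof.
have -> : rectangle a b = [set` `]-a, a[] `*` [set` `]-b, b[].
  by apply/seteqP; split => x /=; rewrite /rectangle/= !ltr_norml !in_itv.
rewrite lebesgue2X//=.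
by rewrite !lebesgue_measure_itv/=; do 2 case: ifP => _;
  rewrite ?mul0e ?mule0 ?ltry// -!EFinD -EFinM ltry.
Qed.

Lemma open_rectangle (a b : R) : open (rectangle a b).
Proof.
rewrite (_ : rectangle a b = (fst @^-1` [set` `]-a, a[]) `&` (snd @^-1` [set` `]-b, b[])).
  apply: openI; apply: open_comp; try exact: interval_open.
    by move=> x _; exact: cvg_fst.
  by move=> x _; exact: cvg_snd.
by apply/seteqP; split => x /=; rewrite /rectangle/= !ltr_norml !in_itv.
Qed.

Lemma measurable_rectangle (a b : R) : measurable (rectangle a b).
Proof. by apply: open_measurable2; exact: open_rectangle. Qed.

Lemma open_lebesgue2_gt0 A x : open A -> A x -> (0 < mu A)%E.
Proof.
move=> oA Ax.
have := open_nbhs_nbhs (conj oA Ax).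
move=> [[B C] [/= nB nC] BC].
have {nB} /nbhs_ballP[e /= e0 eB] := nB.
have {nC} /nbhs_ballP[h /= h0 hC] := nC.
apply: (@lt_le_trans _ _ (mu (ball x.1 e `*` ball x.2 h))).
  rewrite lebesgue2X; [|exact: measurable_ball..].
  by rewrite !lebesgue_measure_ball ?ltW ?mule_gt0 ?lte_fin ?mulrn_wgt0.
apply: le_measure; rewrite ?inE.
- by apply: measurableX; exact: measurable_ball.
- exact: open_measurable2.
- by move=> y [/= /eB ? /hC ?]; exact: BC.
Qed.

Lemma lebesgue2_ae2 (P Q S : R * R -> Prop) :
  {ae mu, forall x, P x} -> {ae mu, forall x, Q x} ->
  (forall x, P x -> Q x -> S x) -> {ae mu, forall x, S x}.
Proof.
move=> HP HQ H; apply: (negligibleS _ (negligibleU HP HQ)).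
move=> x /= nS; apply: contrapT => /not_orP[nP nQ].
by apply: nS; apply: H; apply: contrapT.
Qed.

Lemma lebesgue2_ae (P S : R * R -> Prop) : {ae mu, forall x, P x} ->
  (forall x, P x -> S x) -> {ae mu, forall x, S x}.
Proof. by move=> HP H; apply: (lebesgue2_ae2 HP HP) => x Px _; exact: H. Qed.

(** A nonempty open set has positive measure, so an open exceptional set is empty. *)
Lemma ae_open A (P : set (R * R)) : open A -> open (A `&` ~` P) ->
  {ae mu, forall x, A x -> P x} -> forall x, A x -> P x.
Proof.
move=> oA oP [N [mN N0 AN]] x Ax; apply: contrapT => nPx.
have := @open_lebesgue2_gt0 _ x oP (conj Ax nPx).
rewrite -N0 ltNge le_measure// ?inE//; first exact: open_measurable2.
by move=> y [Ay nPy]; apply: AN => /= /(_ Ay).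
Qed.

End plane_measure.

(** * Integrals of partial derivatives *)

Section divergence.
Variables (R : realType) (a b : R).
Hypotheses (a0 : 0 < a) (b0 : 0 < b).
Local Notation mu := (@lebesgue2 R).
Local Notation U := (rectangle a b).
Implicit Types (f g : R * R -> R) (x : R * R).

Let e1 : R * R := (1, 0).
Let e2 : R * R := (0, 1).

Lemma continuous_bounded_rectangle f : continuous f ->
  exists2 M : R, 0 < M & forall x, U x -> `|f x| <= M.
Proof.
move=> cf.
have cK : compact ([set` `[-a, a]] `*` [set` `[-b, b]] : set (R * R)).
  by apply: compact_setX; exact: segment_compact.
have /compact_bounded[M [_ HM]] : compact (f @` ([set` `[-a, a]] `*` [set` `[-b, b]])).
  by apply: continuous_compact => //; exact: continuous_subspaceT.
exists (`|M| + 1) => [|x [x1 x2]]; first by rewrite ltr_wpDl.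
apply: (HM (`|M| + 1)); first by rewrite (le_lt_trans (ler_norm _))// ltrDl.
exists x => //; split => /=; rewrite in_itv/=; move: x1 x2; rewrite !ltr_norml.
  by move=> /andP[/ltW -> /ltW ->].
by move=> _ /andP[/ltW -> /ltW ->].
Qed.

Lemma bounded_integrable f (M : R) : measurable_fun setT f ->
  (forall x, `|f x| <= M) -> (forall x, ~ U x -> f x = 0) ->
  mu.-integrable setT (EFin \o f).
Proof.
move=> mf fM f0.
have mU := measurable_rectangle a b.
have -> : EFin \o f = (EFin \o f) \_ U.
  apply/funext => x; rewrite patchE; case: ifPn => //; rewrite notin_setE => /f0 /=.
  by move=> ->.
apply: (@integrable_mkcond _ _ R mu U (EFin \o f) mU).1.
apply: measurable_bounded_integrable => //.
- exact: lebesgue2_rectangle.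
- exact: measurable_funTS.
- exists M; split; first exact: num_real.
  by move=> r Mr x _ /=; rewrite (le_trans (fM x))// ltW.
Qed.

Lemma is_derive_slice1 f (x1 x2 d : R) : is_derive ((x1, x2) : R * R) e1 f d ->
  is_derive x1 1 (fun s => f (s, x2)) d.
Proof.
move=> /is_derive_line H; apply/is_derive_line; move: H; congr is_derive.
apply/funext => h; congr f; rewrite /e1; congr pair => /=.
by rewrite /GRing.scale/= mulr0 add0r.
Qed.

Lemma is_derive_slice2 f (x1 x2 d : R) : is_derive ((x1, x2) : R * R) e2 f d ->
  is_derive x2 1 (fun s => f (x1, s)) d.
Proof.
move=> /is_derive_line H; apply/is_derive_line; move: H; congr is_derive.
apply/funext => h; congr f; rewrite /e2; congr pair => /=.
by rewrite /GRing.scale/= mulr0 add0r.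
Qed.

Lemma integral_derivative_eq0 (F g : R -> R) (c : R) : 0 < c ->
  (forall t : R, is_derive t 1 F (g t)) -> continuous g ->
  F c = 0 -> F (- c) = 0 ->
  (\int[lebesgue_measure]_(t in `](- c)%R, c[) (g t)%:E = 0)%E.
Proof.
move=> c0 dF cg Fc FNc.
have cF := continuous_derivable1 dF.
rewrite -(integral_itv_bndoo true false); last first.
  by apply/measurable_EFinP; apply: measurable_funTS; exact: continuous_measurable_fun.
rewrite (@continuous_FTC2 _ g F)//; first by rewrite Fc FNc sube0.
- by rewrite gtrN.
- exact: continuous_subspaceT.
- split => [t _||]; first by have [] := dF t.
  + by apply: cvg_at_right_filter; exact: cF.
  + by apply: cvg_at_left_filter; exact: cF.
- by move=> t _; rewrite derive1E; have [_ ->] := dF t.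
Qed.

(** Fubini, then the fundamental theorem of calculus on each horizontal segment: f vanishes outside
    the open rectangle, in particular at both ends of the segment. *)
Lemma integral_pd1_eq0 f g : (forall x, is_derive x e1 f (g x)) ->
  continuous g -> (forall x, ~ U x -> f x = 0) ->
  (\int[mu]_(x in U) (g x)%:E = 0)%E.
Proof.
move=> df cg f0.
have [M M0 gM] := continuous_bounded_rectangle cg.
have mg := continuous_measurable2 cg.
have mU := measurable_rectangle a b.
have I : mu.-integrable setT (EFin \o (g \_ U)).
  apply: (@bounded_integrable _ M).
  - by apply/(measurable_restrictT _ _).1 => //; exact: measurable_funTS.
  - by move=> x; rewrite patchE; case: ifPn => [/set_mem/gM//|_]; rewrite normr0 ltW.
  - by move=> x Ux; rewrite patchE memNset.
rewrite integral_mkcond.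
transitivity (\int[mu]_x (g \_ U x)%:E)%E.
  by apply: eq_integral => x _; rewrite !patchE; case: ifP.
have := @integral21_prod_meas1 _ _ (measurableTypeR R) (measurableTypeR R) R
  lebesgue_measure lebesgue_measure _ I.
move=> <-; apply: integral0_eq => y _; rewrite /fubini_G/=.
have [yb|yb] := ltP `|y| b; last first.
  apply: integral0_eq => x _; rewrite patchE memNset// => -[_ /=].
  by rewrite ltNge yb.
transitivity (\int[lebesgue_measure]_(t in `](- a)%R, a[) (g (t, y))%:E)%E.
  rewrite [RHS]integral_mkcond; apply: eq_integral => t _; rewrite !patchE.
  have -> : ((t, y) \in U) = (t \in `]-a, a[%classic).
    by apply/idP/idP => /set_mem H; apply/mem_set; move: H; rewrite /rectangle/= in_itv/= (ltr_norml t); [case|].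
  by case: ifP.
apply: (@integral_derivative_eq0 (fun t => f (t, y))) => //.
- by move=> t; exact: is_derive_slice1.
- move=> t; apply: (@continuous_comp _ _ _ (fun t => (t, y))); last exact: cg.
  apply: (@cvg_pair _ _ _ _ (nbhs t) (nbhs y)); last exact: cvg_cst.
  exact: cvg_id.
- by apply: f0 => -[/=]; rewrite gtr0_norm// ltxx.
- by apply: f0 => -[/=]; rewrite normrN gtr0_norm// ltxx.
Qed.

Lemma integral_pd2_eq0 f g : (forall x, is_derive x e2 f (g x)) ->
  continuous g -> (forall x, ~ U x -> f x = 0) ->
  (\int[mu]_(x in U) (g x)%:E = 0)%E.
Proof.
move=> df cg f0.
have [M M0 gM] := continuous_bounded_rectangle cg.
have mg := continuous_measurable2 cg.
have mU := measurable_rectangle a b.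
have I : mu.-integrable setT (EFin \o (g \_ U)).
  apply: (@bounded_integrable _ M).
  - by apply/(measurable_restrictT _ _).1 => //; exact: measurable_funTS.
  - by move=> x; rewrite patchE; case: ifPn => [/set_mem/gM//|_]; rewrite normr0 ltW.
  - by move=> x Ux; rewrite patchE memNset.
rewrite integral_mkcond.
transitivity (\int[mu]_x (g \_ U x)%:E)%E.
  by apply: eq_integral => x _; rewrite !patchE; case: ifP.
have := @integral12_prod_meas1 _ _ (measurableTypeR R) (measurableTypeR R) R
  lebesgue_measure lebesgue_measure _ I.
move=> <-; apply: integral0_eq => y _; rewrite /fubini_F/=.
have [yb|yb] := ltP `|y| a; last first.
  apply: integral0_eq => x _; rewrite patchE memNset// => -[/=].
  by rewrite ltNge yb.
transitivity (\int[lebesgue_measure]_(t in `](- b)%R, b[) (g (y, t))%:E)%E.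
  rewrite [RHS]integral_mkcond; apply: eq_integral => t _; rewrite !patchE.
  have -> : ((y, t) \in U) = (t \in `]-b, b[%classic).
    by apply/idP/idP => /set_mem H; apply/mem_set; move: H; rewrite /rectangle/= in_itv/= (ltr_norml t); [case|].
  by case: ifP.
apply: (@integral_derivative_eq0 (fun t => f (y, t))) => //.
- by move=> t; exact: is_derive_slice2.
- move=> t; apply: (@continuous_comp _ _ _ (fun t => (y, t))); last exact: cg.
  apply: (@cvg_pair _ _ _ _ (nbhs y) (nbhs t)); last exact: cvg_id.
  exact: cvg_cst.
- by apply: f0 => -[_ /=]; rewrite gtr0_norm// ltxx.
- by apply: f0 => -[_ /=]; rewrite normrN gtr0_norm// ltxx.
Qed.

End divergence.

(** * Test functions and zero boundary values *)

Section test_functions.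
Variables (R : realType) (U : set (R * R)).
Implicit Types (f g : R * R -> R) (x : R * R).

(** The support is closed and contained in [U], so even a boundary point of [U] has a neighbourhood
    that misses it. *)
Lemma test_near0 f x : test_function U f -> ~ U x -> \forall y \near x, f y = 0.
Proof.
move=> [_ _ fU] Ux.
have : nbhs x (~` closure [set x | f x != 0]).
  apply: open_nbhs_nbhs; split; last by move=> /fU.
  exact/closed_openC/closed_closure.
apply: filterS => y /= fy; apply: contrapT => /eqP fy0.
by apply: fy; exact: subset_closure.
Qed.

Lemma test_eq0 f x : test_function U f -> ~ U x -> f x = 0.
Proof. by move=> tf Ux; exact: (nbhs_singleton (test_near0 tf Ux)). Qed.

Lemma test_Sn f n : test_function U f -> Sn n f.
Proof. by move=> [/smoothP]. Qed.

Lemma test_pd f : test_function U f ->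
  [/\ continuous f, continuous (pd1 f), continuous (pd2 f),
      forall x, is_derive x ((1, 0) : R * R) f (pd1 f x) &
      forall x, is_derive x ((0, 1) : R * R) f (pd2 f x)].
Proof.
move=> [sf _ _]; have [cf d1 d2] := sf [::].
have [c1 _ _] := sf [:: true]; have [c2 _ _] := sf [:: false].
split; [exact: cf|exact: c1|exact: c2| |] => x; apply: DeriveDef.
- exact: d1.
- exact: erefl.
- exact: d2.
- exact: erefl.
Qed.

Lemma test_pd_eq0 f x : test_function U f -> ~ U x ->
  pd1 f x = 0 /\ pd2 f x = 0.
Proof.
move=> tf Ux; have f0 := test_near0 tf Ux.
by split; rewrite /pd1 /pd2 (near_eq_derive (g := cst 0))//; exact: derive_cst.
Qed.

Lemma test_sub f g : test_function U f -> (forall n, Sn n g) ->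
  (forall x, f x = 0 -> g x = 0) -> test_function U g.
Proof.
move=> [_ cf fU] sg fg.
have S : closure [set x | g x != 0] `<=` closure [set x | f x != 0].
  by apply: closure_subset => x /=; apply: contra_neq; exact: fg.
split; first exact/smoothP.
- by apply: subclosed_compact cf S; exact: closed_closure.
- exact: subset_trans fU.
Qed.

Lemma test_supp g K : (forall n, Sn n g) -> compact K -> closed K -> K `<=` U ->
  (forall x, ~ K x -> g x = 0) -> test_function U g.
Proof.
move=> sg cK kK KU g0.
have S : closure [set x | g x != 0] `<=` K.
  rewrite ((closure_id K).1 kK); apply: closure_subset => x /= gx.
  by apply: contrapT => /g0 /eqP; exact/negP.
split; first exact/smoothP.
- by apply: subclosed_compact cK S; exact: closed_closure.
- exact: subset_trans KU.
Qed.

End test_functions.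

(** * Zero boundary values for functions extended by zero *)

Section H0.
Variables (R : realType) (a b : R).
Local Notation mu := (@lebesgue2 R).
Local Notation U := (rectangle a b).
Implicit Types (v f g : R * R -> R) (D : R * R -> R * R) (x : R * R).

Definition err v D f x : R :=
  (v x - f x) ^+ 2 + ((D x).1 - pd1 f x) ^+ 2 + ((D x).2 - pd2 f x) ^+ 2.

Definition measurable_pair v D :=
  [/\ measurable_fun setT v, measurable_fun setT (fun x => (D x).1) &
      measurable_fun setT (fun x => (D x).2)].

(* H^1_0(U) for functions extended by zero to the plane, where the reflection
   preserves integrals; the weak gradient identity follows from the
   approximation clause. *)
Definition H0 v D :=
  [/\ measurable_pair v D,
      forall x, ~ U x -> v x = 0 /\ D x = (0, 0) &
      forall e, 0 < e -> exists2 f, test_function U f &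
        (\int[mu]_x (err v D f x)%:E < e%:E)%E].

Lemma err_ge0 v D f x : 0 <= err v D f x.
Proof. by rewrite !addr_ge0 ?sqr_ge0. Qed.

Lemma measurable_err_on (X : set (R * R)) v D f : measurable_fun X v ->
  measurable_fun X (fun x => (D x).1) -> measurable_fun X (fun x => (D x).2) ->
  test_function U f -> measurable_fun X (err v D f).
Proof.
move=> mv m1 m2 tf; have [cf c1 c2 _ _] := test_pd tf.
apply: measurable_funD; first apply: measurable_funD;
  apply: measurable_funX; apply: measurable_funB => //;
  apply: measurable_funTS; exact: continuous_measurable2.
Qed.

Lemma measurable_err v D f : measurable_pair v D -> test_function U f ->
  measurable_fun setT (err v D f).
Proof. by move=> [mv m1 m2]; exact: measurable_err_on. Qed.

Lemma test_bounded f : test_function U f ->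
  exists2 M : R, 0 < M & forall x, [/\ `|f x| <= M, `|pd1 f x| <= M & `|pd2 f x| <= M].
Proof.
move=> tf; have [cf c1 c2 _ _] := test_pd tf.
have [M M0 HM] := @continuous_bounded_rectangle R a b _ cf.
have [M1 M10 HM1] := @continuous_bounded_rectangle R a b _ c1.
have [M2 M20 HM2] := @continuous_bounded_rectangle R a b _ c2.
exists (M + M1 + M2) => [|x]; first by rewrite !addr_gt0.
have [Ux|Ux] := pselect (U x).
  split; [apply: le_trans (HM _ Ux) _|apply: le_trans (HM1 _ Ux) _|
    apply: le_trans (HM2 _ Ux) _].
  - by rewrite -addrA lerDl addr_ge0 ?ltW.
  - by rewrite addrAC lerDr addr_ge0 ?ltW.
  - by rewrite lerDr addr_ge0 ?ltW.
have [-> ->] := test_pd_eq0 tf Ux; rewrite (test_eq0 tf Ux) normr0.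
by split; rewrite !addr_ge0 ?ltW.
Qed.

(** A single test function at squared distance below 1 suffices, since it is bounded together with
    its derivatives and vanishes outside [U]. *)
Lemma H0_integrable v D : H0 v D ->
  [/\ mu.-integrable setT (EFin \o (fun x => v x ^+ 2)),
      mu.-integrable setT (EFin \o (fun x => (D x).1 ^+ 2)) &
      mu.-integrable setT (EFin \o (fun x => (D x).2 ^+ 2))].
Proof.
move=> vD; have [[mv m1 m2] v0 av] := vD.
have [f tf fe] := av 1 ltr01.
have [cf c1 c2 _ _] := test_pd tf.
have [M M0 HM] := test_bounded tf.
have ierr : mu.-integrable setT (EFin \o err v D f).
  apply/integrableP; split; first by apply/measurable_EFinP; exact: measurable_err.
  apply: le_lt_trans (lt_trans fe (ltry 1)).
  rewrite le_eqVlt; apply/orP; left; apply/eqP; apply: eq_integral => x _ /=.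
  by rewrite ger0_norm ?err_ge0.
have I (h k : R * R -> R) : measurable_fun setT h -> continuous k ->
    (forall x, `|k x| <= M) -> (forall x, ~ U x -> k x = 0) ->
    (forall x, (h x - k x) ^+ 2 <= err v D f x) ->
    mu.-integrable setT (EFin \o (fun x => h x ^+ 2)).
  move=> mh ck kM k0 hk.
  have ik : mu.-integrable setT (EFin \o (fun x => k x ^+ 2)).
    apply: (@bounded_integrable R a b _ (M ^+ 2)).
    - by apply: measurable_funX; exact: continuous_measurable2.
    - by move=> x; rewrite normrX; apply: lerXn2r (kM x); rewrite nnegrE// ltW.
    - by move=> x /k0 ->; rewrite expr0n.
  have /= i2 := integrableD measurableT (integrableZl measurableT 2 ierr)
    (integrableZl measurableT 2 ik).
  apply: le_integrable i2 => //.
    by apply/measurable_EFinP; exact: measurable_funX.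
  move=> x _ /=; rewrite lee_fin ger0_norm ?sqr_ge0//.
  have k2 := sqr_ge0 (k x).
  rewrite [leRHS]ger0_norm; last first.
    by apply: addr_ge0; apply: mulr_ge0 => //; exact: err_ge0.
  (* The identity 2 (h - k)^2 + 2 k^2 - h^2 = (h - 2 k)^2. *)
  have := hk x; have := sqr_ge0 (h x - k x *+ 2); nra.
split.
- apply: (I _ f) => // x; first by have [] := HM x.
    exact: test_eq0.
  by rewrite /err -addrA lerDl addr_ge0 ?sqr_ge0.
- apply: (I _ (pd1 f)) => // x; first by have [] := HM x.
    by move=> /(test_pd_eq0 tf)[].
  by rewrite /err addrAC lerDr addr_ge0 ?sqr_ge0.
- apply: (I _ (pd2 f)) => // x; first by have [] := HM x.
    by move=> /(test_pd_eq0 tf)[].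
  by rewrite /err lerDr addr_ge0 ?sqr_ge0.
Qed.

Lemma integrable_indic_rectangle : mu.-integrable setT (EFin \o (\1_U : R * R -> R)).
Proof.
apply: (@bounded_integrable R a b _ 1).
- by apply/measurable_indicP; exact: measurable_rectangle.
- by move=> x; rewrite indicE ger0_norm// lern1 leq_b1.
- by move=> x Ux; rewrite indicE memNset.
Qed.

(** [U] has finite measure and |f| <= f^2 + 1 on it. *)
Lemma square_integrable_integrable f : measurable_fun setT f ->
  (forall x, ~ U x -> f x = 0) ->
  mu.-integrable setT (EFin \o (fun x => f x ^+ 2)) ->
  mu.-integrable setT (EFin \o f).
Proof.
move=> mf f0 f2.
have /= i2 := integrableD measurableT f2 integrable_indic_rectangle.
apply: le_integrable i2 => //; first exact/measurable_EFinP.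
move=> x _ /=; rewrite lee_fin indicE.
rewrite [leRHS]ger0_norm ?addr_ge0 ?sqr_ge0//.
have [/mem_set -> /=|/f0 ->] := pselect (U x); last first.
  by rewrite normr0 addr_ge0 ?sqr_ge0.
by rewrite -real_normK ?num_real//; have := sqr_ge0 (`|f x| - 1); nra.
Qed.

End H0.

(** * Transfer of approximations and integration by parts *)

Section H0_transfer.
Variables (R : realType) (a b : R).
Hypotheses (a0 : 0 < a) (b0 : 0 < b).
Local Notation mu := (@lebesgue2 R).
Local Notation U := (rectangle a b).
Implicit Types (v f g : R * R -> R) (D : R * R -> R * R) (x : R * R).

Definition unitv (i : bool) : R * R := if i then (1, 0) else (0, 1).
Definition coord (i : bool) (y : R * R) : R := if i then y.1 else y.2.
Definition pd (i : bool) (f : R * R -> R) : R * R -> R := if i then pd1 f else pd2 f.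

Lemma integral_rectangle_out f : (forall x, ~ U x -> f x = 0) ->
  \int[mu]_(x in U) f x = \int[mu]_x f x.
Proof.
move=> f0; rewrite Rintegral_mkcond; congr Rintegral; apply/funext => x.
by rewrite patchE; case: ifPn => //; rewrite notin_setE => /f0.
Qed.

(** The common form of all constructions of competitors: apply the same operation to the test
    functions and dominate the error pointwise. A reflected error is allowed on the right because
    [rho] preserves integrals; the two terms together explain the tolerance e / (2 C). *)
Lemma approx_dom v D v' D' (r s C : R) : 0 < C -> H0 a b v D ->
  measurable_pair v' D' -> (forall x, ~ U x -> v' x = 0 /\ D' x = (0, 0)) ->
  (forall f, test_function U f -> exists2 g, test_function U g &
     forall x, err v' D' g x <= C * (err v D f x + err v D f (rho r s x))) ->
  H0 a b v' D'.
Proof.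
move=> C0 vD m' out' H; split => // e e0.
have [m _ av] := vD.
have [|f tf fe] := av (e / (2 * C)); first by rewrite divr_gt0 ?mulr_gt0.
have [g tg fg] := H f tf; exists g => //.
have mf : measurable_fun setT (fun x => (err v D f x)%:E).
  by apply/measurable_EFinP; exact: measurable_err tf.
have mfr : measurable_fun setT (fun x => (err v D f (rho r s x))%:E).
  apply: (measurableT_comp mf); exact: measurable_rho.
have f0 x : (0 <= (err v D f x)%:E)%E by rewrite lee_fin err_ge0.
apply: (@le_lt_trans _ _ (\int[mu]_x (C%:E * ((err v D f x)%:E + (err v D f (rho r s x))%:E)))%E).
  apply: ge0_le_integral => //.
  - by move=> x _; rewrite lee_fin err_ge0.
  - by apply/measurable_EFinP; exact: measurable_err tg.
  - by apply: measurable_funeM; exact: emeasurable_funD.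
  - by move=> x _; rewrite -EFinD -EFinM lee_fin.
rewrite ge0_integralZl//; last 3 first.
  - exact: emeasurable_funD.
  - by move=> x _; rewrite adde_ge0.
  - by rewrite lee_fin ltW.
rewrite ge0_integralD//.
rewrite (@ge0_integral_rho R r s (fun x => (err v D f x)%:E))//.
have i0 : (0 <= \int[mu]_x (err v D f x)%:E)%E by exact: integral_ge0.
move: fe i0; case: (\int[mu]_x _)%E => // t; rewrite !lte_fin => te _.
move: te; rewrite ltr_pdivlMr ?mulr_gt0// => te.
by apply: le_lt_trans te; rewrite mulrDr; lra.
Qed.

Lemma integral_pd_eq0 (i : bool) f g :
  (forall x, is_derive x (unitv i) f (g x)) ->
  continuous g -> (forall x, ~ U x -> f x = 0) ->
  (\int[mu]_(x in U) (g x)%:E = 0)%E.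
Proof. by case: i; [exact: integral_pd1_eq0|exact: integral_pd2_eq0]. Qed.

Lemma test_pd_dir (i : bool) f : test_function U f ->
  continuous (pd i f) /\ forall x, is_derive x (unitv i) f (pd i f x).
Proof.
move=> /test_pd[_ c1 c2 d1 d2]; case: i; [exact: (conj c1 d1)|exact: (conj c2 d2)].
Qed.

Lemma err_val v D f x : (v x - f x) ^+ 2 <= err v D f x.
Proof. by rewrite /err -addrA lerDl addr_ge0 ?sqr_ge0. Qed.

Lemma err_coord i v D f x : (coord i (D x) - pd i f x) ^+ 2 <= err v D f x.
Proof.
case: i => /=; first by rewrite /err addrAC lerDr addr_ge0 ?sqr_ge0.
by rewrite /err lerDr addr_ge0 ?sqr_ge0.
Qed.

Lemma H0_measurable_coord i v D : H0 a b v D ->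
  measurable_fun setT (fun x => coord i (D x)).
Proof. by move=> [[]]; case: i. Qed.

Lemma H0_integrable_val v D (B : R * R -> R) : H0 a b v D -> continuous B ->
  mu.-integrable setT (EFin \o (fun x => v x * B x)).
Proof.
move=> vD cB; have [i1 _ _] := H0_integrable vD.
have [[mv _ _] out _] := vD.
have [M M0 HM] := @continuous_bounded_rectangle R a b _ cB.
have iv := square_integrable_integrable mv (fun x Ux => (out x Ux).1) i1.
have /= i2 := integrableZl measurableT M (integrable_abse iv).
apply: le_integrable i2 => //.
  apply/measurable_EFinP; apply: measurable_funM => //; exact: continuous_measurable2.
move=> x _ /=; rewrite lee_fin normrM [leRHS]ger0_norm; last by apply: mulr_ge0 => //; exact: ltW.
rewrite mulrC.
have [/HM Bx|/out[-> _]] := pselect (U x); first by rewrite ler_wpM2r.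
by rewrite normr0 !mulr0.
Qed.

Lemma H0_integrable_coord i v D (B : R * R -> R) : H0 a b v D -> continuous B ->
  mu.-integrable setT (EFin \o (fun x => coord i (D x) * B x)).
Proof.
move=> vD cB; have [_ i1 i2] := H0_integrable vD.
have [_ out _] := vD; have mv := H0_measurable_coord i vD.
have out' x : ~ U x -> coord i (D x) = 0 by move=> /out[_ ->]; case: (i).
have [M M0 HM] := @continuous_bounded_rectangle R a b _ cB.
have iv : mu.-integrable setT (EFin \o (fun x => coord i (D x))).
  by apply: (square_integrable_integrable mv out'); case: (i).
have /= i3 := integrableZl measurableT M (integrable_abse iv).
apply: le_integrable i3 => //.
  apply/measurable_EFinP; apply: measurable_funM => //; exact: continuous_measurable2.
move=> x _ /=; rewrite lee_fin normrM [leRHS]ger0_norm; last by apply: mulr_ge0 => //; exact: ltW.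
rewrite mulrC.
have [/HM Bx|/out' ->] := pselect (U x); first by rewrite ler_wpM2r.
by rewrite normr0 !mulr0.
Qed.

Lemma eps_le0 (t K : R) : 0 <= K -> (forall e, 0 < e -> t <= K * e) -> t <= 0.
Proof.
move=> K0 H; apply/ler_addgt0Pr => e e0; rewrite add0r.
have K1 : 0 < K + 1 by lra.
apply: le_trans (H (e / (K + 1)) _) _; first exact: divr_gt0.
by rewrite mulrCA ler_piMr ?ltW// ltr_pdivrMr//; lra.
Qed.

(** [B] is arbitrary on the boundary, so the identity encodes the zero boundary values of [v]. It is
    exact for test functions and passes to the limit. It yields the weak gradient, and with an
    affine [B] the vanishing criterion [H0_eq0]. *)
Lemma H0_ibp i v D (B B1 : R * R -> R) : H0 a b v D ->
  (forall x, is_derive x (unitv i) B (B1 x)) -> continuous B -> continuous B1 ->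
  \int[mu]_x (v x * B1 x + coord i (D x) * B x) = 0.
Proof.
move=> vD dB cB cB1.
have [m out av] := vD.
have out' x : ~ U x -> coord i (D x) = 0 by move=> /out[_ ->]; case: (i).
have [M M0 HM] := @continuous_bounded_rectangle R a b _ cB.
have [M1 M10 HM1] := @continuous_bounded_rectangle R a b _ cB1.
pose F x := v x * B1 x + coord i (D x) * B x.
have iF : mu.-integrable setT (EFin \o F).
  have /= := integrableD measurableT (H0_integrable_val vD cB1) (H0_integrable_coord i vD cB).
  by [].
have mF : measurable_fun setT F.
  by apply/measurable_EFinP; exact: measurable_int iF.
have mU := measurable_rectangle a b.
have Uoo := lebesgue2_rectangle a b.
(* [M + M1] bounds |B| + |B1| on [U]; the measure of [U] and 1 account for the two terms of Young's
   inequality below. *)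
pose K := (M + M1) * (fine (mu U) + 1).
have K0 : 0 <= K by rewrite mulr_ge0 ?addr_ge0 ?fine_ge0// ltW.
apply/eqP; rewrite -normr_le0; apply: (eps_le0 K0) => e e0.
have [|f tf fe] := av (e ^+ 2); first by rewrite exprn_gt0.
have [cf _ _ _ _] := test_pd tf; have [cpf df] := test_pd_dir i tf.
have f0 x : ~ U x -> f x = 0 /\ pd i f x = 0.
  move=> Ux; split; first exact: test_eq0 tf Ux.
  by have [p1 p2] := test_pd_eq0 tf Ux; case: (i).
pose G x := f x * B1 x + pd i f x * B x.
have cG : continuous G.
  by move=> x; apply: cvgD; apply: cvgM; [exact: cf|exact: cB1|exact: cpf|exact: cB].
have G0 : (\int[mu]_x (G x)%:E = 0)%E.
  have H : (\int[mu]_(x in U) (G x)%:E = 0)%E.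
    apply: (@integral_pd_eq0 i (fun x => f x * B x)) => // x.
      apply: (@is_derive_eq _ _ _ _ _ _ _ _ (is_deriveM (df x) (dB x))).
      by rewrite /G /GRing.scale/= (mulrC (B x)).
    by move=> /f0[-> _]; rewrite mul0r.
  rewrite -[RHS]H [RHS]integral_mkcond; apply: eq_integral => x _.
  rewrite patchE; case: ifPn => //; rewrite notin_setE => /f0[fx px].
  by rewrite /G fx px !mul0r addr0.
have mG := continuous_measurable2 cG.
have merr := measurable_err m tf.
have Fe : (\int[mu]_x (F x)%:E)%E = (\int[mu]_x (F x - G x)%:E)%E.
  have iG : mu.-integrable setT (EFin \o G).
    have [N N0 HN] := @continuous_bounded_rectangle R a b _ cG.
    apply: (@bounded_integrable R a b _ N) => // x.
      have [/HN//|/f0[fx px]] := pselect (U x).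
      by rewrite /G fx px !mul0r addr0 normr0 ltW.
    by move=> /f0[fx px]; rewrite /G fx px !mul0r addr0.
  have /= := integralB measurableT iF iG.
  by rewrite [X in (_ - X)%E]G0 sube0 => <-.
have e20 : 0 <= (2 * e)^-1 by rewrite invr_ge0 mulr_ge0// ltW.
have FG x : `|F x - G x| <= (M + M1) * (e * \1_U x + (2 * e)^-1 * err v D f x).
  have [Ux|Ux] := pselect (U x); last first.
    have [fx px] := f0 _ Ux; have [vx _] := out _ Ux.
    rewrite /F /G fx px vx (out' _ Ux) !mul0r addr0 subrr normr0.
    apply: mulr_ge0; first by apply: addr_ge0; exact: ltW.
    apply: addr_ge0; apply: mulr_ge0; [exact: ltW|by rewrite indicE|exact: e20|exact: err_ge0].
  rewrite indicE mem_set//= mulr1.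
  have -> : F x - G x = (v x - f x) * B1 x + (coord i (D x) - pd i f x) * B x.
    by rewrite /F /G; ring.
  (* Young's inequality with weight [e] takes the place of Cauchy-Schwarz: the integral of [err] is
     below e^2, so both terms have integral of order e. *)
  have young t : t ^+ 2 <= err v D f x -> `|t| <= e + (2 * e)^-1 * err v D f x.
    move=> te; rewrite -(ler_pM2l (_ : 0 < 2 * e)) ?mulr_gt0// mulrDr mulVKf; last first.
      by rewrite gt_eqF// mulr_gt0.
    apply: le_trans (lerD (lexx _) te); rewrite -(real_normK (num_real t)).
    by have := sqr_ge0 (e - `|t|); have := normr_ge0 t; nra.
  apply: le_trans (ler_normD _ _) _; rewrite !normrM mulrDl addrC; apply: lerD.
    by rewrite mulrC ler_pM ?HM// young// err_coord.
  by rewrite mulrC ler_pM ?HM1// young// err_val.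
rewrite -lee_fin; apply: (@le_trans _ _ (\int[mu]_x `|(F x - G x)%:E|)%E).
  have -> : (`|\int[mu]_x F x|%:E = `|\int[mu]_x (F x - G x)%:E|)%E.
    rewrite -Fe /Rintegral -[in RHS](@fineK _ (\int[mu]_x (F x)%:E)%E)//.
    by apply: integrable_fin_num.
  apply: le_abse_integral => //.
  by apply/measurable_EFinP; exact: measurable_funB.
apply: (@le_trans _ _ (\int[mu]_x ((M + M1)%:E * (e%:E * (\1_U x)%:E + (2 * e)^-1%:E * (err v D f x)%:E)))%E).
  apply: ge0_le_integral => //.
  - by apply/measurable_EFinP; apply: measurableT_comp => //; exact: measurable_funB.
  - apply/measurable_EFinP; apply: measurable_funM => //; apply: measurable_funD.
      by apply: measurable_funM => //; exact: measurable_indicP.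
    exact: measurable_funM.
  - by move=> x _; rewrite lee_fin; exact: FG.
have m1 : measurable_fun setT (fun x => (\1_U x)%:E : \bar R).
  by apply/measurable_EFinP/measurable_indicP.
have m2 : measurable_fun setT (fun x => (err v D f x)%:E).
  exact/measurable_EFinP.
have p1 x : (0 <= e%:E * (\1_U x)%:E)%E by rewrite -EFinM lee_fin mulr_ge0// ltW.
have p2 x : (0 <= (2 * e)^-1%:E * (err v D f x)%:E)%E.
  by rewrite -EFinM lee_fin mulr_ge0// err_ge0.
rewrite ge0_integralZl//; last 3 first.
- by apply: emeasurable_funD; exact: measurable_funeM.
- by move=> x _; rewrite adde_ge0.
- by rewrite lee_fin addr_ge0// ltW.
rewrite ge0_integralD//; [|exact: measurable_funeM|exact: measurable_funeM].
rewrite ge0_integralZl//; last by rewrite lee_fin ltW.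
rewrite ge0_integralZl//; last by move=> x _; rewrite lee_fin err_ge0.
rewrite integral_indic// setIT.
have i0 : (0 <= \int[mu]_x (err v D f x)%:E)%E.
  by apply: integral_ge0 => x _; rewrite lee_fin err_ge0.
have Ufin : mu U \is a fin_num by rewrite ge0_fin_numE.
rewrite -(fineK Ufin).
move: fe i0; case: (\int[mu]_x _)%E => // t; rewrite lte_fin lee_fin => te t0.
rewrite lee_fin /K -mulrA; apply: ler_wpM2l; first by apply: addr_ge0; exact: ltW.
rewrite [leRHS]mulrDl mul1r (mulrC e) lerD2l mulrC ler_pdivrMr ?mulr_gt0//.
by move: te; rewrite expr2; nra.
Qed.

End H0_transfer.

(** * The gradient constraint and the minimizer *)

Section gamma_ball.
Variables (R : realType) (q : R).
Hypothesis q1 : 1 < q.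
Implicit Types (x y : R * R).

Let q0 : 0 < q. Proof. exact: lt_trans q1. Qed.

Lemma gamma_le1 x : gamma q x <= 1 <-> `|x.1| `^ q + `|x.2| `^ q <= 1.
Proof.
have s0 : 0 <= `|x.1| `^ q + `|x.2| `^ q by rewrite addr_ge0 ?powR_ge0.
split=> H.
  have := @ge0_ler_powR R q (ltW q0) _ 1 _ _ H.
  rewrite powR1 -powRrM mulVf ?gt_eqF// powRr1//.
  by apply; rewrite nnegrE// powR_ge0.
have := @ge0_ler_powR R q^-1 _ _ 1 _ _ H; rewrite powR1; apply.
- by rewrite invr_ge0 ltW.
- by rewrite nnegrE.
- by rewrite nnegrE.
Qed.

Lemma gamma_coord_le1 i x : gamma q x <= 1 -> `|coord i x| <= 1.
Proof.
move=> /gamma_le1 H.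
have {}H : `|coord i x| `^ q <= 1.
  apply: le_trans H; case: i => /=; first by rewrite lerDl powR_ge0.
  by rewrite lerDr powR_ge0.
rewrite leNgt; apply/negP => x1; move: H; apply/negP; rewrite -ltNge.
by rewrite (lt_le_trans x1)// le1r_powR// ltW.
Qed.

Lemma powR_convex (s t c : R) : 0 <= s -> 0 <= t -> 0 <= c <= 1 ->
  ((1 - c) * s + c * t) `^ q <= (1 - c) * s `^ q + c * t `^ q.
Proof.
move=> s0 t0 /andP[c0 c1].
have := @convex_powR R q (ltW q1) (Itv01 c0 c1) t s.
rewrite (addrC _ (c * t)) (addrC _ (c * t `^ q)).
by apply; rewrite inE/= in_itv/= ?t0 ?s0.
Qed.

(** Once the root is removed, this is convexity of t^q in each coordinate. *)
Lemma gamma_convex x y (c : R) : 0 <= c <= 1 -> gamma q x <= 1 -> gamma q y <= 1 ->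
  gamma q ((1 - c) * x.1 + c * y.1, (1 - c) * x.2 + c * y.2) <= 1.
Proof.
move=> c01; move: (c01) => /andP[c0 c1] /gamma_le1 gx /gamma_le1 gy; apply/gamma_le1 => /=.
have H (s t : R) : `|(1 - c) * s + c * t| `^ q <= (1 - c) * `|s| `^ q + c * `|t| `^ q.
  apply: le_trans (powR_convex (normr_ge0 s) (normr_ge0 t) c01).
  apply: ge0_ler_powR; rewrite ?nnegrE ?addr_ge0 ?mulr_ge0 ?subr_ge0//; first exact: ltW.
  by apply: le_trans (ler_normD _ _) _; rewrite !normrM (ger0_norm c0) ger0_norm ?subr_ge0.
apply: le_trans (lerD (H _ _) (H _ _)) _.
have -> : (1 - c) * `|x.1| `^ q + c * `|y.1| `^ q + ((1 - c) * `|x.2| `^ q + c * `|y.2| `^ q)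
  = (1 - c) * (`|x.1| `^ q + `|x.2| `^ q) + c * (`|y.1| `^ q + `|y.2| `^ q) by ring.
apply: (@le_trans _ _ ((1 - c) * 1 + c * 1)); last by rewrite !mulr1 subrK.
by apply: lerD; apply: ler_wpM2l; rewrite ?subr_ge0.
Qed.

Lemma gamma_swap (s t : R) : gamma q (s, t) = gamma q (t, s).
Proof. by rewrite /gamma/= addrC. Qed.

Lemma gamma00 : gamma q (0, 0) <= 1.
Proof. by apply/gamma_le1; rewrite /= normr0 powR0 ?gt_eqF// addr0 ler01. Qed.

Lemma measurable_gamma d (T : measurableType d) (A : set T) (D : T -> R * R) :
  measurable_fun A (fun t => (D t).1) -> measurable_fun A (fun t => (D t).2) ->
  measurable_fun A (fun t => gamma q (D t)).
Proof.
move=> m1 m2; apply: (measurableT_comp (measurable_powR _)).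
apply: measurable_funD; apply: (measurableT_comp (measurable_powR _));
  exact: measurableT_comp.
Qed.

End gamma_ball.

(** * From the extended space back to [H10]; a vanishing criterion *)

Section H10_H0.
Variables (R : realType) (a b : R).
Hypotheses (a0 : 0 < a) (b0 : 0 < b).
Local Notation mu := (@lebesgue2 R).
Local Notation U := (rectangle a b).
Implicit Types (v f g : R * R -> R) (D : R * R -> R * R) (x : R * R).

Lemma H0_H10 v D : H0 a b v D -> H10 U v D.
Proof.
move=> vD; have [i0 i1 i2] := H0_integrable vD; have [m out av] := vD.
have [mv m1 m2] := m.
have mU := measurable_rectangle a b.
split; last first.
  move=> e e0; have [|f tf fe] := av (e ^+ 2); first by rewrite exprn_gt0.
  exists f => //; apply: le_lt_trans fe.
  apply: ge0_subset_integral => //.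
    by apply/measurable_EFinP; exact: measurable_err m tf.
  by move=> x _; rewrite lee_fin err_ge0.
have iU h : mu.-integrable setT h -> mu.-integrable U h.
  exact: integrableS.
split.
- by split; [exact: measurable_funTS|exact: (iU _ i0)].
- by split; [exact: measurable_funTS|exact: (iU _ i1)].
- by split; [exact: measurable_funTS|exact: (iU _ i2)].
move=> f tf.
have [cf c1 c2 d1 d2] := test_pd tf.
(* Integration by parts with the test function itself as multiplier. *)
have W (i : bool) : \int[mu]_(x in U) (v x * pd i f x) =
    - \int[mu]_(x in U) (coord i (D x) * f x).
  have [cp dp] := test_pd_dir i tf.
  have := H0_ibp a0 b0 vD dp cf cp.
  rewrite RintegralD//; [|exact: (H0_integrable_val vD cp)|exact: (H0_integrable_coord i vD cf)].
  move/eqP; rewrite addr_eq0 => /eqP H.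
  rewrite !integral_rectangle_out//.
    by move=> x /out[_ ->]; case: (i); rewrite mul0r.
  by move=> x /out[-> _]; rewrite mul0r.
by split; [exact: (W true)|exact: (W false)].
Qed.

(* In the identity int (w + (x_2 - b) D_2 w) = 0 both terms are nonnegative. *)
Lemma H0_eq0 w D : H0 a b w D -> (forall x, 0 <= w x) ->
  {ae mu, forall x, (D x).2 <= 0} -> {ae mu, forall x, w x = 0}.
Proof.
move=> wD w0 D0; have [[mw m1 m2] out _] := wD.
pose F x := w x * 1 + coord false (D x) * (x.2 - b).
have dB x : is_derive x (unitv R false) (fun x : R * R => x.2 - b) 1.
  apply/is_derive_line.
  rewrite (_ : (fun h : R => _) = (fun h => h *: (1 : R) + (x.2 - b))).
    exact: is_derive_affine.
  by apply/funext => h /=; rewrite addrA.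
have cB : continuous (fun x : R * R => x.2 - b).
  by move=> x; apply: cvgB; [exact: cvg_snd|exact: cvg_cst].
have c1 : continuous (fun x : R * R => 1 : R) by move=> x; exact: cvg_cst.
have iF0 : \int[mu]_x F x = 0 := H0_ibp a0 b0 wD dB cB c1.
have iF : mu.-integrable setT (EFin \o F).
  exact: (integrableD measurableT (H0_integrable_val wD c1) (H0_integrable_coord false wD cB)).
have mF := measurable_int _ iF.
have sgn x : (D x).2 <= 0 -> 0 <= coord false (D x) * (x.2 - b).
  move=> Dx; have [[_ /=]|/out[_ ->]] := pselect (U x); last by rewrite mul0r.
  rewrite ltr_norml => /andP[_ xb]; rewrite mulr_le0// subr_le0 ltW//.
have F0 : {ae mu, forall x, `|(F x)%:E|%E = (F x)%:E}.
  apply: (lebesgue2_ae D0) => x Dx; rewrite gee0_abs// lee_fin.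
  by rewrite addr_ge0 ?mulr1// sgn.
have : (\int[mu]_x `|(F x)%:E| = 0)%E.
  transitivity (\int[mu]_x (F x)%:E)%E.
    apply: ae_eq_integral => //; first exact: measurableT_comp mF.
    by apply: (lebesgue2_ae F0) => x ->.
  rewrite -[LHS](@fineK _ (\int[mu]_x (F x)%:E)%E); last exact: integrable_fin_num.
  by rewrite -[fine _]/(\int[mu]_x F x) iF0.
move/(ae_eq_integral_abs mu measurableT mF) => F00.
apply: (lebesgue2_ae2 D0 F00) => x Dx /(_ I) /= [Fx].
apply/eqP; rewrite eq_le w0 andbT.
by have := sgn x Dx; have : F x = 0 by []; rewrite /F; lra.
Qed.

End H10_H0.

(** * The minimizer extended to the plane *)

Section normal_form.
Variables (R : realType) (a b q eta : R).
Hypotheses (a0 : 0 < a) (b0 : 0 < b) (q1 : 1 < q).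
Local Notation mu := (@lebesgue2 R).
Local Notation U := (rectangle a b).
Implicit Types (v f g : R * R -> R) (D : R * R -> R * R) (x : R * R).

Definition density v D x : R :=
  2^-1 * ((D x).1 ^+ 2 + (D x).2 ^+ 2) - eta * v x.

Lemma density_out v D x : H0 a b v D -> ~ U x -> density v D x = 0.
Proof.
move=> [_ out _] /out[vx Dx].
by rewrite /density vx Dx/= mulr0 expr0n/= addr0 mulr0 subr0.
Qed.

Lemma energy_H0 v D : H0 a b v D -> energy eta U v D = \int[mu]_x density v D x.
Proof.
by move=> vD; rewrite -(@integral_rectangle_out R a b)// => x; exact: density_out.
Qed.

(* The gradient is changed on a null set so that its constraint holds at every
   point. *)
Lemma minimizer_normal_form u : minimizer q eta U u ->
  exists A, [/\ H0 a b (u \_ U) A, forall x, gamma q (A x) <= 1 &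
    forall v D, H0 a b v D -> (forall x, gamma q (D x) <= 1) ->
      \int[mu]_x density (u \_ U) A x <= \int[mu]_x density v D x].
Proof.
move=> [Du [[[[mu_ u2] [m1 D12] [m2 D22] _] ap] g1] umin].
have mU := measurable_rectangle a b.
pose S := U `&` [set x | gamma q (Du x) <= 1].
have mS : measurable S.
  rewrite (_ : S = U `&` (fun x => gamma q (Du x)) @^-1` [set` `]-oo, 1]]).
    by apply: (measurable_gamma q m1 m2).
  by apply/seteqP; split => x [Ux /=]; rewrite in_itv.
(* The zero vector satisfies the constraint; it replaces the gradient where the constraint fails and
   outside [U]. *)
pose A x := if x \in S then Du x else (0, 0).
have gA x : gamma q (A x) <= 1.
  by rewrite /A; case: ifPn => [/set_mem[]//|_]; exact: gamma00.
have out x : ~ U x -> (u \_ U) x = 0 /\ A x = (0, 0).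
  move=> Ux; rewrite patchE memNset// /A memNset//; exact: (fun h => Ux h.1).
have SU : S `<=` U by move=> x [].
have mA1 : measurable_fun setT (fun x => (A x).1).
  rewrite (_ : (fun x => _) = (fun x => (Du x).1) \_ S).
    apply: (measurable_restrictT (fun x => (Du x).1) mS).1.
    exact: (measurable_funS mU SU m1).
  by apply/funext => x; rewrite patchE /A; case: ifP.
have mA2 : measurable_fun setT (fun x => (A x).2).
  rewrite (_ : (fun x => _) = (fun x => (Du x).2) \_ S).
    apply: (measurable_restrictT (fun x => (Du x).2) mS).1.
    exact: (measurable_funS mU SU m2).
  by apply/funext => x; rewrite patchE /A; case: ifP.
have mu' : measurable_fun setT (u \_ U).
  exact: (measurable_restrictT _ mU).1.
have eqU x : gamma q (Du x) <= 1 \/ ~ U x -> U x -> (u \_ U) x = u x /\ A x = Du x.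
  move=> [gx|//] Ux; rewrite patchE mem_set// /A mem_set//.
have aeU : {ae mu, forall x, U x -> (u \_ U) x = u x /\ A x = Du x}.
  apply: (lebesgue2_ae g1) => x gx Ux; apply: eqU => //; left; exact: gx.
have uA : H0 a b (u \_ U) A.
  split => // e e0.
  (* [H10] compares the squared error with e^2, [H0] compares it with e. *)
  have [|f tf fe] := ap (Num.sqrt e); first by rewrite sqrtr_gt0.
  exists f => //; move: fe; rewrite sqr_sqrtr ?ltW//; apply: le_lt_trans.
  rewrite le_eqVlt; apply/orP; left; apply/eqP.
  transitivity (\int[mu]_(x in U) (err (u \_ U) A f x)%:E)%E.
    rewrite [RHS]integral_mkcond; apply: eq_integral => x _.
    rewrite patchE; case: ifPn => //; rewrite notin_setE => Ux.
    rewrite /err; have [-> ->] := out _ Ux; have [-> ->] := test_pd_eq0 tf Ux.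
    by rewrite (test_eq0 tf Ux)/= subrr expr0n/= !addr0.
  apply: ge0_ae_eq_integral => //.
  - by apply/measurable_EFinP; apply: measurable_funTS; exact: (@measurable_err R a b _ _ _ _ tf).
  - by apply/measurable_EFinP; exact: (@measurable_err_on R a b _ _ _ _ _ _ _ tf).
  - by move=> x _; rewrite lee_fin err_ge0.
  - by move=> x _; rewrite lee_fin err_ge0.
  - by apply: (lebesgue2_ae aeU) => x H Ux; rewrite /err; have [-> ->] := H Ux.
exists A; split => // v D vD gD.
rewrite -!energy_H0//.
have -> : energy eta U (u \_ U) A = energy eta U u Du.
  rewrite /energy /Rintegral; congr fine; apply: ae_eq_integral => //.
  - apply/measurable_EFinP; apply: measurable_funTS; apply: measurable_funB.
      apply: measurable_funM => //; apply: measurable_funD; exact: measurable_funX.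
    exact: measurable_funM.
  - apply/measurable_EFinP; apply: measurable_funB.
      apply: measurable_funM => //; apply: measurable_funD; exact: measurable_funX.
    exact: measurable_funM.
  - by apply: (lebesgue2_ae aeU) => x H Ux; have [-> ->] := H Ux.
apply: umin; split; first exact: H0_H10.
by apply: (@aeW _ _ _ mu (fun x => U x -> gamma q (D x) <= 1)) => x _; exact: gD.
Qed.

End normal_form.

(** * Truncation of the minimizer *)

Section cutoff.
Variable R : realType.

(** The threshold is [d] and not 0: a continuous function that is 0 at a point is cut to 0 around
    it, which is what [clean_cut] asks for. *)
Definition cutoff (d t : R) : R := trunc d (t - d).
Definition cutoff' (d t : R) : R := trunc' d (t - d).

Lemma Cn_cutoff d n : 0 < d -> Cn n (cutoff d).
Proof.
move=> d0; rewrite (_ : cutoff d = (fun t => trunc d (1 * t + (- d)))).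
  by apply: Cn_affine; exact: Cn_trunc.
by apply/funext => t; rewrite mul1r.
Qed.

Lemma is_derive_cutoff (d t : R) : 0 < d -> is_derive t 1 (cutoff d) (cutoff' d t).
Proof.
move=> d0; rewrite -[cutoff' d t]mulr1.
apply: (@is_derive1_comp R (trunc d) (fun t => t - d)); first exact: is_derive_trunc.
by apply: is_derive_eq; rewrite subr0.
Qed.

Lemma cutoff_le0 (d t : R) : 0 < d -> t <= d -> cutoff d t = 0.
Proof. by move=> d0 td; rewrite /cutoff trunc_le0 ?subr_le0. Qed.

Lemma cutoff'_le0 (d t : R) : 0 < d -> t <= d -> cutoff' d t = 0.
Proof. by move=> d0 td; rewrite /cutoff' trunc'_le0 ?subr_le0. Qed.

Lemma cutoff_eq0 (d t : R) : 0 < d -> cutoff d t = 0 -> t <= d.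
Proof.
move=> d0 td; rewrite leNgt; apply/negP => dt.
by have := @trunc_gt0 R d d0 (t - d); rewrite -/(cutoff d t) td subr_gt0 ltxx => /(_ dt).
Qed.

Lemma continuous_cutoff (d : R) : 0 < d -> continuous (cutoff d).
Proof. by move=> d0; exact: Cn_continuous (@Cn_cutoff d 0%N d0). Qed.

Lemma continuous_cutoff' (d : R) : 0 < d -> continuous (cutoff' d).
Proof.
move=> d0 t; apply: (@continuous_comp _ _ _ (fun t => t - d) (trunc' d)).
  by apply: cvgB; [exact: cvg_id|exact: cvg_cst].
exact: continuous_trunc'.
Qed.

(** Here [d] stands for a component of the limit gradient, bounded thanks to the constraint, and
    [d'] for that of a test function, on which no uniform bound is available. *)
Lemma chain_err (c c' d d' L B t s : R) : 0 <= c' <= 1 ->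
  `|c - c'| <= L * `|t - s| -> `|d| <= B ->
  (c * d - c' * d') ^+ 2 <= 2 * (d - d') ^+ 2 + 2 * (L * B) ^+ 2 * (t - s) ^+ 2.
Proof.
move=> /andP[c0 c1] cL dB.
have -> : c * d - c' * d' = c' * (d - d') + (c - c') * d by ring.
have H1 : (c' * (d - d')) ^+ 2 <= (d - d') ^+ 2.
  by rewrite exprMn ler_piMl ?sqr_ge0// exprn_ile1.
have H2 : ((c - c') * d) ^+ 2 <= (L * B) ^+ 2 * (t - s) ^+ 2.
  rewrite -exprMn -(real_normK (num_real (_ * d))) -(real_normK (num_real (L * B * _))).
  have B0 : 0 <= B := le_trans (normr_ge0 d) dB.
  apply: lerXn2r; rewrite ?nnegrE ?normr_ge0//.
  rewrite !normrM (ger0_norm B0) mulrAC; apply: ler_pM => //.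
  by apply: le_trans cL _; rewrite ler_wpM2r// ler_norm.
move: H1 H2; set X := c' * (d - d'); set Y := (c - c') * d => H1 H2.
have := sqr_ge0 (X - Y); rewrite sqrrB sqrrD => H3.
rewrite -mulrA; lra.
Qed.

(** Origin of 4 + 16 L^2: 4 is the square of the factor 2 in the first hypothesis, and each of the
    two derivatives, being bounded by 2, contributes 2 (2 L)^2 = 8 L^2. *)
Lemma trunc_err (phi phi' : R -> R) (L t s d1 d2 e1 e2 : R) :
  `|phi t - phi s| <= 2 * `|t - s| -> 0 <= phi' s <= 1 ->
  `|phi' t - phi' s| <= L * `|t - s| -> `|d1| <= 2 -> `|d2| <= 2 ->
  (phi t - phi s) ^+ 2 + (phi' t * d1 - phi' s * e1) ^+ 2 +
    (phi' t * d2 - phi' s * e2) ^+ 2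
  <= (4 + 16 * L ^+ 2) * ((t - s) ^+ 2 + (d1 - e1) ^+ 2 + (d2 - e2) ^+ 2).
Proof.
move=> p0 p1 p2 D1 D2.
have H1 := chain_err e1 p1 p2 D1; have H2 := chain_err e2 p1 p2 D2.
have H0 : (phi t - phi s) ^+ 2 <= 4 * (t - s) ^+ 2.
  rewrite -(real_normK (num_real (phi t - _))) -(real_normK (num_real (t - s))).
  have -> : 4 * `|t - s| ^+ 2 = (2 * `|t - s|) ^+ 2 by ring.
  by apply: lerXn2r p0; rewrite nnegrE ?mulr_ge0.
have S1 := sqr_ge0 (d1 - e1); have S2 := sqr_ge0 (d2 - e2).
have L2 := sqr_ge0 L.
have P1 := mulr_ge0 L2 S1; have P2 := mulr_ge0 L2 S2.
move: H0 H1 H2 S1 S2 P1 P2; rewrite exprMn.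
move: (_ ^+ 2) (_ ^+ 2) (_ ^+ 2) => X Y Z.
by nra.
Qed.

End cutoff.

(** * The bound of u by the height above the bottom side *)

Section upper_bound.
Variables (R : realType) (a b : R).
Hypotheses (a0 : 0 < a) (b0 : 0 < b).
Local Notation mu := (@lebesgue2 R).
Local Notation U := (rectangle a b).
Implicit Types (v f g u : R * R -> R) (D A : R * R -> R * R) (x : R * R).

Lemma is_derive_pd i f x (d : R) : is_derive x (unitv R i) f d -> pd i f x = d.
Proof. by case: i => -[]. Qed.

Lemma trunc'_01 (d t : R) : 0 <= trunc' d t <= 1.
Proof. by rewrite trunc'_ge0 ltW// trunc'_lt1. Qed.

Lemma cutoff_lipschitz (d s t : R) : 0 < d ->
  `|cutoff d s - cutoff d t| <= 2 * `|s - t|.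
Proof.
move=> d0; apply: le_trans (trunc_lipschitz d0 _ _) _.
by rewrite opprB addrA subrK -[leLHS]mul1r ler_wpM2r// ler1n.
Qed.

Lemma cutoff'_lipschitz (d s t : R) : 0 < d ->
  `|cutoff' d s - cutoff' d t| <= 27 / d * `|s - t|.
Proof.
move=> d0; apply: le_trans (trunc'_lipschitz d0 _ _) _.
by rewrite opprB addrA subrK.
Qed.

(** Near a point outside [U] the test function vanishes and the argument of the cutoff is -(x_2 +
    b), which is below d as long as x_2 > -b - d; further down there is no point of [U] nearby. *)
Lemma clean_cut_rectangle (d : R) f : 0 < d -> test_function U f ->
  clean_cut U (fun x => cutoff d (f x - (x.2 + b))).
Proof.
move=> d0 tf x; have [Ux|Ux] := pselect (U x).
  by apply: Or31; apply: open_nbhs_nbhs; split => //; exact: open_rectangle.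
have f0 := test_near0 tf Ux.
have [xb|xb] := ltP (- b - d) x.2; [apply: Or33|apply: Or32].
  have y2 : \forall y \near x, - b - d < y.2.
    have c : (y : R * R).2 @[y --> x] --> x.2 by exact: cvg_snd.
    exact: (c _ (lt_nbhsr xb)).
  by apply: filterS2 f0 y2 => y -> yb; apply: cutoff_le0 => //; lra.
have y2 : \forall y \near x, y.2 < - b.
  have c : (y : R * R).2 @[y --> x] --> x.2 by exact: cvg_snd.
  have xb' : x.2 < - b by lra.
  exact: (c _ (lt_nbhsl xb')).
by apply: filterS y2 => y yb [_ /=]; rewrite ltr_norml => /andP[]; lra.
Qed.

(* The truncated excess w of v over x_2 + b lies in H^1_0(U), is nonnegative and
   has D_2 w <= 0. *)
Lemma H0_upper v D (d : R) : 0 < d -> H0 a b v D ->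
  (forall i x, `|coord i (D x)| <= 1) ->
  {ae mu, forall x, U x -> v x <= x.2 + b + d}.
Proof.
move=> d0 vD D1.
pose s x := v x - (x.2 + b).
pose w := (fun x => cutoff d (s x)) \_ U.
pose Dw x := if x \in U then
  (cutoff' d (s x) * (D x).1, cutoff' d (s x) * ((D x).2 - 1)) else (0, 0).
have [[mv m1 m2] out _] := vD.
have mU := measurable_rectangle a b.
have ms : measurable_fun setT s.
  apply: measurable_funB => //; apply: measurable_funD => //; exact: measurable_snd.
have ms' : measurable_fun setT (fun x => cutoff' d (s x)).
  apply: (measurableT_comp _ ms); apply: continuous_measurable_fun.
  exact: continuous_cutoff'.
have mpatch (h : R * R -> R) : measurable_fun setT h -> measurable_fun setT (h \_ U).
  by move=> mh; apply: (measurable_restrictT h mU).1; exact: measurable_funTS.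
have wD : H0 a b w Dw.
  (* The reflection with parameters [0 0] is an arbitrary choice: the error at [x] alone bounds the
     left side. The constant is that of [trunc_err] with L = 27/d. *)
  apply: (@approx_dom _ _ _ v D w Dw 0 0 (4 + 16 * (27 / d) ^+ 2)) => //.
  - by rewrite ltr_pwDl// mulr_ge0// sqr_ge0.
  - split.
    + apply: mpatch; apply: (measurableT_comp _ ms); apply: continuous_measurable_fun.
      exact: continuous_cutoff.
    + rewrite (_ : (fun x => _) = (fun x => cutoff' d (s x) * (D x).1) \_ U).
        by apply: mpatch; exact: measurable_funM.
      by apply/funext => x; rewrite /Dw patchE; case: ifP.
    + rewrite (_ : (fun x => _) = (fun x => cutoff' d (s x) * ((D x).2 - 1)) \_ U).
        by apply: mpatch; apply: measurable_funM => //; exact: measurable_funB.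
      by apply/funext => x; rewrite /Dw patchE; case: ifP.
  - by move=> x Ux; rewrite /w /Dw patchE memNset.
  move=> f tf.
  pose sf x := f x - (x.2 + b).
  have cc := clean_cut_rectangle d0 tf.
  have Ssf n : Sn n sf.
    apply: SnD; first exact: test_Sn tf.
    by apply: SnN; apply: SnD; [exact: Sn_snd|exact: Sn_cst].
  have [cf c1 c2 d1 d2] := test_pd tf.
  exists ((fun x => cutoff d (sf x)) \_ U).
    apply: (test_sub tf) => [n|x fx].
      apply: Sn_patch => //; apply: (@Sn_comp _ _ (cutoff d) sf) => //.
      exact: Cn_cutoff.
    rewrite patchE; case: ifPn => // /set_mem[_]; rewrite ltr_norml => /andP[xb _].
    by apply: cutoff_le0 => //; rewrite /sf fx; lra.
  have dsf1 x : is_derive x ((1, 0) : R * R) sf (pd1 f x).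
    have := is_deriveB (d1 x) (_ : is_derive x ((1, 0) : R * R) (fun x => x.2 + b) 0).
    rewrite subr0; apply; apply/is_derive_line.
    rewrite (_ : (fun h : R => _) = (fun h => h *: (0 : R) + (x.2 + b))).
      exact: is_derive_affine.
    by apply/funext => h /=; rewrite addrA.
  have dsf2 x : is_derive x ((0, 1) : R * R) sf (pd2 f x - 1).
    apply: (is_deriveB (d2 x)); apply/is_derive_line.
    rewrite (_ : (fun h : R => _) = (fun h => h *: (1 : R) + (x.2 + b))).
      exact: is_derive_affine.
    by apply/funext => h /=; rewrite addrA.
  have P1 x : pd1 ((fun x => cutoff d (sf x)) \_ U) x =
      ((fun x => cutoff' d (sf x) * pd1 f x) \_ U) x.
    apply: (@is_derive_pd true); apply: clean_cut_is_derive cc _ => y.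
    exact: is_derive_comp_dir (is_derive_cutoff _ d0) (dsf1 y).
  have P2 x : pd2 ((fun x => cutoff d (sf x)) \_ U) x =
      ((fun x => cutoff' d (sf x) * (pd2 f x - 1)) \_ U) x.
    apply: (@is_derive_pd false); apply: clean_cut_is_derive cc _ => y.
    exact: is_derive_comp_dir (is_derive_cutoff _ d0) (dsf2 y).
  move=> x; set C := 4 + _.
  have C0 : 0 <= C by rewrite addr_ge0// mulr_ge0// sqr_ge0.
  rewrite /err P1 P2 /w /Dw !patchE; case: ifPn => xU; last first.
    rewrite /= !subr0 expr0n/= !addr0 mulr_ge0// addr_ge0//; exact: err_ge0.
  apply: (@le_trans _ _ (C * err v D f x)); last first.
    by rewrite ler_wpM2l// lerDl; exact: err_ge0.
  rewrite /err/=.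
  have -> : v x - f x = s x - sf x by rewrite /s /sf; ring.
  have -> : (D x).2 - pd2 f x = ((D x).2 - 1) - (pd2 f x - 1) by ring.
  apply: trunc_err.
  - exact: cutoff_lipschitz.
  - exact: trunc'_01.
  - exact: cutoff'_lipschitz.
  - by apply: le_trans (D1 true x) _; rewrite ler1n.
  - apply: le_trans (ler_normB _ _) _; rewrite normr1.
    by have /= := D1 false x; lra.
have /= w0 : {ae mu, forall x, w x = 0}.
  apply: (H0_eq0 a0 b0 wD).
    by move=> x; rewrite /w patchE; case: ifP => // _; exact: trunc_ge0.
  apply: (@aeW _ _ _ mu (fun x => (Dw x).2 <= 0)) => x; rewrite /Dw; case: ifP => //= _.
  have /= := D1 false x; rewrite ler_norml => /andP[_ Dx].
  by rewrite mulr_ge0_le0// ?subr_le0//; exact: trunc'_ge0.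
apply: (lebesgue2_ae w0) => x + Ux; rewrite /w patchE mem_set// => /cutoff_eq0.
by move=> /(_ d0); rewrite /s; lra.
Qed.

End upper_bound.

(** * Integrals under reflection, truncation from below, nonnegativity of u *)

Section nonnegativity.
Variables (R : realType) (a b q eta : R).
Hypotheses (q1 : 1 < q) (eta0 : 0 < eta).
Local Notation mu := (@lebesgue2 R).
Local Notation U := (rectangle a b).
Implicit Types (v f g u h : R * R -> R) (D A : R * R -> R * R) (x : R * R).

Lemma integral_le0_ae h : mu.-integrable setT (EFin \o h) ->
  (forall x, 0 <= h x) -> \int[mu]_x h x <= 0 -> {ae mu, forall x, h x = 0}.
Proof.
move=> ih h0 H.
have mh := measurable_int _ ih.
have : (\int[mu]_x `|(EFin \o h) x| = 0)%E.
  apply/eqP; rewrite eq_le; apply/andP; split; last by apply: integral_ge0.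
  have <- : ((\int[mu]_x h x)%:E = \int[mu]_x `|(EFin \o h) x|)%E.
    rewrite /Rintegral fineK; last exact: integrable_fin_num ih.
    by apply: eq_integral => x _ /=; rewrite ger0_norm.
  by rewrite lee_fin.
move/(ae_eq_integral_abs mu measurableT mh) => H0.
by apply: (lebesgue2_ae H0) => x /(_ I) [].
Qed.

Lemma integrable_rho (r s : R) h : mu.-integrable setT (EFin \o h) ->
  mu.-integrable setT (EFin \o (h \o rho r s)).
Proof.
move=> ih; have mh := measurable_int _ ih.
have mr := measurable_rho r s.
have mhr : measurable_fun setT (EFin \o (h \o rho r s)).
  exact: (measurableT_comp mh mr).
apply/integrableP; split => //.
rewrite (@ge0_integral_rho R r s (fun x => `|(h x)%:E|)%E)//.
- by have /integrableP[] := ih.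
- exact: measurableT_comp mh.
Qed.

Lemma integral_rho (r s : R) h : mu.-integrable setT (EFin \o h) ->
  \int[mu]_x h (rho r s x) = \int[mu]_x h x.
Proof.
move=> ih; have mh := measurable_int _ ih.
rewrite /Rintegral; congr fine.
rewrite [LHS]integralE [RHS]integralE; congr (_ - _)%E.
- rewrite -[RHS](@ge0_integral_rho R r s _ (measurable_funepos mh) (funepos_ge0 _)).
  by apply: eq_integral => x _; rewrite (funepos_comp (EFin \o h) (rho r s)).
- rewrite -[RHS](@ge0_integral_rho R r s _ (measurable_funeneg mh) (funeneg_ge0 _)).
  by apply: eq_integral => x _; rewrite (funeneg_comp (EFin \o h) (rho r s)).
Qed.

Lemma density_integrable v D : H0 a b v D ->
  mu.-integrable setT (EFin \o density eta v D).
Proof.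
move=> vD; have [i0 i1 i2] := H0_integrable vD.
have [[mv _ _] out _] := vD.
have iv := square_integrable_integrable mv (fun x Ux => (out x Ux).1) i0.
have /= j1 := integrableZl measurableT 2^-1 (integrableD measurableT i1 i2).
have /= j2 := integrableZl measurableT eta iv.
exact: (integrableB measurableT j1 j2).
Qed.

(** A truncation from below that is the identity on nonnegative numbers. It serves twice: with d = 1
    to prove u >= 0, and then to keep the test functions approximating u above -d. *)
Definition chi (d t : R) : R := t + trunc d (- t).
Definition chi' (d t : R) : R := 1 - trunc' d (- t).

Lemma Cn_chi (d : R) n : 0 < d -> Cn n (chi d).
Proof.
move=> d0; apply: CnD; first exact: Cn_id.
rewrite (_ : (fun _ => _) = (fun t => trunc d (- 1 * t + 0))).
  by apply: Cn_affine; exact: Cn_trunc.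
by apply/funext => t; rewrite addr0 mulN1r.
Qed.

Lemma is_derive_chi (d t : R) : 0 < d -> is_derive t 1 (chi d) (chi' d t).
Proof.
move=> d0.
have dN : is_derive t 1 (fun s : R => - s) (- 1) by exact: is_deriveN.
have := is_deriveD (is_derive_id t (1 : R)) (is_derive1_comp (is_derive_trunc d0 (- t)) dN).
by rewrite mulrN1.
Qed.

Lemma chi_ge (d t : R) : 0 < d -> - d <= chi d t.
Proof. by move=> d0; have := trunc_ge d0 (- t); rewrite /chi; lra. Qed.

Lemma chi_ge0 (d t : R) : 0 < d -> 0 <= t -> chi d t = t.
Proof. by move=> d0 t0; rewrite /chi trunc_le0 ?addr0// oppr_le0. Qed.

Lemma chi'_ge0 (d t : R) : 0 < d -> 0 <= t -> chi' d t = 1.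
Proof. by move=> d0 t0; rewrite /chi' trunc'_le0 ?subr0// oppr_le0. Qed.

Lemma chi'_01 (d t : R) : 0 <= chi' d t <= 1.
Proof.
have /andP[] := trunc'_01 d (- t); rewrite /chi' => ? ?.
by apply/andP; split; lra.
Qed.

Lemma chi_lipschitz (d s t : R) : 0 < d -> `|chi d s - chi d t| <= 2 * `|s - t|.
Proof.
move=> d0; rewrite /chi.
have -> : s + trunc d (- s) - (t + trunc d (- t)) =
  (s - t) + (trunc d (- s) - trunc d (- t)) by ring.
apply: le_trans (ler_normD _ _) _; rewrite mulrDl mul1r lerD2l.
by apply: le_trans (trunc_lipschitz d0 _ _) _; rewrite opprK addrC distrC.
Qed.

Lemma chi'_lipschitz (d s t : R) : 0 < d -> `|chi' d s - chi' d t| <= 27 / d * `|s - t|.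
Proof.
move=> d0; rewrite /chi'.
have -> : 1 - trunc' d (- s) - (1 - trunc' d (- t)) =
  - (trunc' d (- s) - trunc' d (- t)) by ring.
rewrite normrN; apply: le_trans (trunc'_lipschitz d0 _ _) _.
by rewrite opprK addrC distrC.
Qed.

Lemma chi_test (d : R) f : 0 < d -> test_function U f -> test_function U (chi d \o f).
Proof.
move=> d0 tf; apply: (test_sub tf) => [n|x /= ->]; last exact: chi_ge0.
by apply: Sn_comp; [exact: Cn_chi|exact: test_Sn tf].
Qed.

Lemma pd_chi (d : R) f i x : 0 < d -> test_function U f ->
  pd i (chi d \o f) x = chi' d (f x) * pd i f x.
Proof.
move=> d0 tf; apply: is_derive_pd; have [_ df] := test_pd_dir i tf.
exact: is_derive_comp_dir (is_derive_chi _ d0) (df x).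
Qed.

(** The constant of [trunc_err] for L = 27/d, common to [chi] and [cutoff]. *)
Definition chi_const (d : R) : R := 4 + 16 * (27 / d) ^+ 2.

Lemma chi_const_gt0 (d : R) : 0 < chi_const d.
Proof. by rewrite ltr_pwDl// mulr_ge0// sqr_ge0. Qed.

Lemma err_chi (d : R) v D f x : 0 < d -> test_function U f ->
  (forall i, `|coord i (D x)| <= 1) ->
  err (chi d \o v) (fun x => (chi' d (v x) * (D x).1, chi' d (v x) * (D x).2))
      (chi d \o f) x <= chi_const d * err v D f x.
Proof.
move=> d0 tf D1.
have P1 : pd1 (chi d \o f) x = chi' d (f x) * pd1 f x := pd_chi true x d0 tf.
have P2 : pd2 (chi d \o f) x = chi' d (f x) * pd2 f x := pd_chi false x d0 tf.
rewrite /err P1 P2 /=.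
have D2 (i : bool) : `|coord i (D x)| <= 2.
  by apply: le_trans (D1 i) _; rewrite ler1n.
apply: trunc_err; [exact: chi_lipschitz|exact: chi'_01|exact: chi'_lipschitz| |].
- exact: (D2 true).
- exact: (D2 false).
Qed.

Lemma H0_chi (d : R) v D : 0 < d -> (forall x i, `|coord i (D x)| <= 1) ->
  H0 a b v D ->
  H0 a b (chi d \o v) (fun x => (chi' d (v x) * (D x).1, chi' d (v x) * (D x).2)).
Proof.
move=> d0 D1 vD; have [[mv m1 m2] out _] := vD.
have cchi' : continuous (chi' d).
  move=> t; apply: cvgB; first exact: cvg_cst.
  apply: (@continuous_comp _ _ _ (fun t : R => - t) (trunc' d)); first exact: opp_continuous.
  exact: continuous_trunc'.
have mc : measurable_fun setT (fun x => chi' d (v x)).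
  exact: (measurableT_comp (continuous_measurable_fun cchi') mv).
apply: (@approx_dom _ _ _ v D _ _ 0 0 (chi_const d)) => //.
- exact: chi_const_gt0.
- split => //=.
  + apply: (measurableT_comp _ mv); apply: continuous_measurable_fun.
    exact: Cn_continuous (Cn_chi 0 d0).
  + exact: measurable_funM.
  + exact: measurable_funM.
- by move=> x /out[vx Dx] /=; rewrite vx Dx/= !mulr0 chi_ge0.
move=> f tf; exists (chi d \o f); first exact: chi_test.
move=> x; apply: le_trans (err_chi v d0 tf (D1 x)) _.
by rewrite ler_wpM2l ?(ltW (chi_const_gt0 _))// lerDl; exact: err_ge0.
Qed.

(* chi(u) >= u is a competitor with a smaller gradient. *)
Lemma minimizer_ge0 u A : H0 a b u A -> (forall x, gamma q (A x) <= 1) ->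
  (forall v D, H0 a b v D -> (forall x, gamma q (D x) <= 1) ->
      \int[mu]_x density eta u A x <= \int[mu]_x density eta v D x) ->
  {ae mu, forall x, 0 <= u x}.
Proof.
move=> uA gA umin.
have A1 x i : `|coord i (A x)| <= 1 by exact: gamma_coord_le1 (gA x).
have vD := H0_chi ltr01 A1 uA.
set D := (fun x => _) in vD.
have gD x : gamma q (D x) <= 1.
  have c01 : 0 <= 1 - chi' 1 (u x) <= 1.
    have /andP[? ?] := chi'_01 1 (u x); apply/andP; split; lra.
  have := gamma_convex q1 c01 (gA x) (gamma00 q1).
  by rewrite /= !mulr0 !addr0 opprB addrC subrK.
pose h x := density eta u A x - density eta (chi 1 \o u) D x.
have ge x : eta * trunc 1 (- u x) <= h x.
  rewrite /h /density /D /= /chi !exprMn.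
  have /andP[c0 c1] := chi'_01 1 (u x).
  set c := chi' 1 (u x).
  have c2 : c ^+ 2 <= 1 by rewrite exprn_ile1.
  have S1 := sqr_ge0 (A x).1; have S2 := sqr_ge0 (A x).2.
  have H1 : c ^+ 2 * (A x).1 ^+ 2 <= (A x).1 ^+ 2 by rewrite ler_piMl.
  have H2 : c ^+ 2 * (A x).2 ^+ 2 <= (A x).2 ^+ 2 by rewrite ler_piMl.
  lra.
have t0 x : 0 <= eta * trunc 1 (- u x).
  by rewrite mulr_ge0 ?(ltW eta0)// trunc_ge0.
have ih : mu.-integrable setT (EFin \o h).
  exact: (integrableB measurableT (density_integrable uA) (density_integrable vD)).
have hle : \int[mu]_x h x <= 0.
  rewrite RintegralB//; [|exact: density_integrable|exact: density_integrable].
  by rewrite subr_le0; exact: umin.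
apply: (lebesgue2_ae (integral_le0_ae ih (fun x => le_trans (t0 x) (ge x)) hle)) => x hx.
rewrite leNgt; apply/negP => ux.
have := ge x; rewrite hx; apply/negP; rewrite -ltNge mulr_gt0//.
by apply: trunc_gt0 => //; rewrite oppr_gt0.
Qed.

End nonnegativity.

(** * Polarization *)

Section polarization.
Variables (R : realType) (a b : R).
Hypothesis ba : b < a.
Local Notation mu := (@lebesgue2 R).
Local Notation U := (rectangle a b).
Local Notation r := (rho a b).
Implicit Types (v f g u : R * R -> R) (D A : R * R -> R * R) (x : R * R).

Definition above : set (R * R) := [set x | a - b < x.2 - x.1].
Local Notation H := above.

Lemma rhoK x : r (r x) = x.
Proof. by case: x => s t; rewrite /rho/=; congr pair; ring. Qed.

Lemma above_rho x : H x -> ~ H (r x).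
Proof. by rewrite /above /rho/=; lra. Qed.

(** Three of the four bounds come from [U x] and x_2 - x_1 >= a - b; the fourth, x_2 - a + b < a,
    comes from x_2 < b < a. *)
Lemma rho_rectangle x : U x -> a - b <= x.2 - x.1 -> U (r x).
Proof.
rewrite /rectangle /rho/= !ltr_norml => -[/andP[? ?] /andP[? ?]] ?.
by split; apply/andP; split; move: ba; lra.
Qed.

Let cdiff : continuous (fun x : R * R => x.2 - x.1).
Proof. by move=> x; apply: cvgB; [exact: cvg_snd|exact: cvg_fst]. Qed.

Lemma open_above : open H.
Proof.
rewrite (_ : H = (fun x : R * R => x.2 - x.1) @^-1` [set` `]a - b, +oo[]).
  by apply: open_comp => //; exact: interval_open.
by apply/seteqP; split => x /=; rewrite in_itv/= andbT.
Qed.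

Lemma measurable_above : measurable H.
Proof. by apply: open_measurable2; exact: open_above. Qed.

Section cut_difference.
Variables (d : R) (g : R * R -> R).
Hypotheses (d0 : 0 < d) (tg : test_function U g) (gd : forall x, - d <= g x).

Let sg x := g x - g (r x).
(** The function w formed with a test function [g] in place of u. *)
Definition cut_diff : R * R -> R := (fun x => cutoff d (g x - g (r x))) \_ H.

Let csg : continuous sg.
Proof.
have [cg _ _ _ _] := test_pd tg.
move=> x; apply: cvgB; first exact: cg.
by apply: continuous_comp; [exact: rho_continuous|exact: cg].
Qed.

(** On the bisector [rho] fixes x, so the difference is 0 < d and its cutoff vanishes nearby. *)
Lemma clean_cut_diff : clean_cut H (fun x => cutoff d (sg x)).
Proof.
move=> x; have [xH|xH|xH] := ltgtP (a - b) (x.2 - x.1).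
- by apply: Or31; apply: open_nbhs_nbhs; split => //; exact: open_above.
- apply: Or32.
  have : \forall y \near x, y.2 - y.1 < a - b by exact: (cdiff (lt_nbhsl xH)).
  by apply: filterS => y; rewrite /above/=; lra.
- apply: Or33.
  have sx : sg x < d.
    rewrite /sg (_ : r x = x) ?subrr//.
    by rewrite /rho; case: x xH => s t /= xH; congr pair; lra.
  have : \forall y \near x, sg y < d by exact: (csg (lt_nbhsl sx)).
  by apply: filterS => y yd; apply: cutoff_le0 => //; exact: ltW.
Qed.

Lemma cut_diff_Sn n : Sn n cut_diff.
Proof.
apply: Sn_patch; first exact: clean_cut_diff.
apply: (@Sn_comp _ _ (cutoff d) sg); first exact: Cn_cutoff.
by apply: SnD; [exact: test_Sn tg|apply: SnN; apply: Sn_rho; exact: test_Sn tg].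
Qed.

(** Where g = 0 the difference is -g(rho x) <= d, by the lower bound on [g]. This keeps the support
    inside that of [g]. *)
Lemma cut_diff_eq0 x : g x = 0 -> cut_diff x = 0.
Proof.
move=> gx; rewrite /cut_diff patchE; case: ifP => // _.
by apply: cutoff_le0 => //; rewrite gx sub0r lerNl.
Qed.

Lemma cut_diff_test : test_function U cut_diff.
Proof.
by apply: (test_sub tg) => [n|x]; [exact: cut_diff_Sn|exact: cut_diff_eq0].
Qed.

(** The reflected function is supported in the image of the part of the support of [g] where x_2 -
    x_1 >= a - b; [rho_rectangle] keeps this image inside [U], although [rho] does not preserve
    [U]. *)
Lemma cut_diff_rho_test : test_function U (cut_diff \o r).
Proof.
have [_ cK KU] := tg.
pose K0 := closure [set x | g x != 0] `&` (fun x : R * R => x.2 - x.1) @^-1` [set` `[a - b, +oo[].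
have kK0 : closed K0.
  apply: closedI; first exact: closed_closure.
  by apply: closed_comp => // ; exact: interval_closed.
have cK0 : compact K0 by apply: subclosed_compact kK0 cK _ => x [].
have rK : r @` K0 = r @^-1` K0.
  apply/seteqP; split => x /=; first by move=> [y Ky <-]; rewrite rhoK.
  by move=> Kx; exists (r x) => //; exact: rhoK.
apply: (@test_supp _ _ _ (r @^-1` K0)).
- by move=> n; apply: Sn_rho; exact: cut_diff_Sn.
- rewrite -rK; apply: continuous_compact => //.
  by apply: continuous_subspaceT; exact: rho_continuous.
- by apply: closed_comp => // x _; exact: rho_continuous.
- move=> x /= [/KU Urx]; rewrite /= in_itv/= andbT => Hrx.
  by rewrite -(rhoK x); exact: rho_rectangle.
- move=> x Kx /=; rewrite /cut_diff patchE; case: ifPn => // /set_mem Hrx.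
  apply/eqP; apply: contra_notT Kx => Fx; split.
    apply: subset_closure => /=; apply: contra_neq Fx => gx.
    by have := cut_diff_eq0 gx; rewrite /cut_diff patchE mem_set.
  by rewrite /= in_itv/= andbT; exact: ltW.
Qed.

Lemma pd1_cut_diff x : pd1 cut_diff x =
  ((fun x => cutoff' d (g x - g (r x)) * (pd1 g x - pd2 g (r x))) \_ H) x.
Proof.
have [_ _ _ d1 d2] := test_pd tg.
apply: (@is_derive_pd _ true); apply: clean_cut_is_derive clean_cut_diff _ => y.
apply: (is_derive_comp_dir (is_derive_cutoff _ d0)).
by apply: (is_deriveB (d1 y)); apply: (@is_derive_rho R a b g (pd2 g)).
Qed.

Lemma pd2_cut_diff x : pd2 cut_diff x =
  ((fun x => cutoff' d (g x - g (r x)) * (pd2 g x - pd1 g (r x))) \_ H) x.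
Proof.
have [_ _ _ d1 d2] := test_pd tg.
apply: (@is_derive_pd _ false); apply: clean_cut_is_derive clean_cut_diff _ => y.
apply: (is_derive_comp_dir (is_derive_cutoff _ d0)).
by apply: (is_deriveB (d2 y)); apply: (@is_derive_rho R a b g (pd1 g)).
Qed.

Lemma pd1_cut_diff_rho x : pd1 (cut_diff \o r) x = pd2 cut_diff (r x).
Proof.
have [_ _ _ d1 d2] := test_pd cut_diff_test.
exact: (@is_derive_pd _ true _ x _
  (@is_derive_rho R a b cut_diff (pd2 cut_diff) x (unitv R true) d2)).
Qed.

Lemma pd2_cut_diff_rho x : pd2 (cut_diff \o r) x = pd1 cut_diff (r x).
Proof.
have [_ _ _ d1 d2] := test_pd cut_diff_test.
exact: (@is_derive_pd _ false _ x _
  (@is_derive_rho R a b cut_diff (pd1 cut_diff) x (unitv R false) d1)).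
Qed.

End cut_difference.

End polarization.

(** * Elementary inequalities between sums of squares *)

Section squares.
Variable R : realFieldType.
Implicit Types p q t y z : R.

Lemma normrB_le2 p q : `|p| <= 1 -> `|q| <= 1 -> `|p - q| <= 2.
Proof. by move=> p1 q1; apply: le_trans (ler_normB _ _) _; lra. Qed.

Lemma sqr_diff_le p q t z :
  (p - q - (t - z)) ^+ 2 <= 2 * (p - t) ^+ 2 + 2 * (q - z) ^+ 2.
Proof.
have := sqr_ge0 ((p - t) + (q - z)).
have -> : (p - q - (t - z)) ^+ 2 = ((p - t) - (q - z)) ^+ 2 by congr (_ ^+ 2); ring.
by rewrite sqrrB sqrrD; lra.
Qed.

(* The indices 2 and 3 of q and z are crossed because the reflection exchanges
   the two partial derivatives. *)
Lemma sqr_diff3_le p1 p2 p3 q1 q2 q3 t1 t2 t3 z1 z2 z3 :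
  (p1 - q1 - (t1 - z1)) ^+ 2 + (p2 - q3 - (t2 - z3)) ^+ 2 + (p3 - q2 - (t3 - z2)) ^+ 2
  <= 2 * ((p1 - t1) ^+ 2 + (p2 - t2) ^+ 2 + (p3 - t3) ^+ 2 +
          ((q1 - z1) ^+ 2 + (q2 - z2) ^+ 2 + (q3 - z3) ^+ 2)).
Proof.
have := sqr_diff_le p1 q1 t1 z1; have := sqr_diff_le p2 q3 t2 z3.
by have := sqr_diff_le p3 q2 t3 z2; lra.
Qed.

(** With x, y, z the three differences, the right side exceeds the left by (x + y)^2 + (x - z)^2 +
    (y + z)^2. *)
Lemma sqr_sum3_le p1 p2 p3 t1 t2 t3 : (p1 - p2 + p3 - (t1 - t2 + t3)) ^+ 2
  <= 3 * ((p1 - t1) ^+ 2 + (p2 - t2) ^+ 2 + (p3 - t3) ^+ 2).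
Proof.
have -> : p1 - p2 + p3 - (t1 - t2 + t3) = (p1 - t1) - (p2 - t2) + (p3 - t3) by ring.
move: (p1 - t1) (p2 - t2) (p3 - t3) => x y z.
have := sqr_ge0 (x + y); have := sqr_ge0 (x - z); have := sqr_ge0 (y + z).
by nra.
Qed.

Lemma sqr_sum33_le p1 p2 p3 q1 q2 q3 o1 o2 o3 t1 t2 t3 z1 z2 z3 s1 s2 s3 :
  (p1 - q1 + o1 - (t1 - z1 + s1)) ^+ 2 + (p2 - q2 + o3 - (t2 - z2 + s3)) ^+ 2 +
    (p3 - q3 + o2 - (t3 - z3 + s2)) ^+ 2
  <= 3 * ((p1 - t1) ^+ 2 + (p2 - t2) ^+ 2 + (p3 - t3) ^+ 2 +
     ((q1 - z1) ^+ 2 + (q2 - z2) ^+ 2 + (q3 - z3) ^+ 2) +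
     ((o1 - s1) ^+ 2 + (o2 - s2) ^+ 2 + (o3 - s3) ^+ 2)).
Proof.
have := sqr_sum3_le p1 q1 o1 t1 z1 s1; have := sqr_sum3_le p2 q2 o3 t2 z2 s3.
by have := sqr_sum3_le p3 q3 o2 t3 z3 s2; lra.
Qed.

(** The constant is 3 (K + 2 K^2 + 2 K^2): the error of u, then that of w at a point and at its
    mirror image. *)
Lemma combine_le K y z e1 e2 e3 : 0 <= K -> 0 <= z -> e1 <= K * y ->
  e2 <= 2 * K ^+ 2 * (y + z) -> e3 <= 2 * K ^+ 2 * (z + y) ->
  3 * (e1 + e2 + e3) <= (3 * K + 12 * K ^+ 2) * (y + z).
Proof.
move=> K0 z0 h1 h2 h3; have := mulr_ge0 K0 z0.
by rewrite expr2 in h2 h3 *; lra.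
Qed.

End squares.

(** * The polarized competitor and the comparison of u with u o rho *)

Section reflection_inequality.
Variables (R : realType) (a b q eta : R).
Hypotheses (a0 : 0 < a) (b0 : 0 < b) (ba : b < a) (q1 : 1 < q).
Local Notation mu := (@lebesgue2 R).
Local Notation U := (rectangle a b).
Local Notation r := (rho a b).
Local Notation H := (above a b).
Implicit Types (v f g : R * R -> R) (D : R * R -> R * R) (x : R * R).

Variables (u : R * R -> R) (A : R * R -> R * R) (d : R).
Hypotheses (d0 : 0 < d) (uA : H0 a b u A) (gA : forall x, gamma q (A x) <= 1).
Hypotheses (u0 : forall x, 0 <= u x).

Let s x := u x - u (r x).
Let w := (fun x => cutoff d (s x)) \_ H.
(** The slope theta'(s), which is the weight given to the reflected gradient. *)
Let tau := (fun x => cutoff' d (s x)) \_ H.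
Let Dw x : R * R :=
  (tau x * ((A x).1 - (A (r x)).2), tau x * ((A x).2 - (A (r x)).1)).
Let v x := u x - w x + w (r x).
Let Dv x : R * R :=
  ((A x).1 - (Dw x).1 + (Dw (r x)).2, (A x).2 - (Dw x).2 + (Dw (r x)).1).

Let A1 x i : `|coord i (A x)| <= 1.
Proof. exact: gamma_coord_le1 (gA x). Qed.

Let s_out x : ~ U x -> s x <= d.
Proof.
have [_ out _] := uA; move=> /out[ux _].
by rewrite /s ux sub0r (le_trans _ (ltW d0))// oppr_le0.
Qed.

Let w_out x : ~ U x -> w x = 0.
Proof. by move=> Ux; rewrite /w patchE; case: ifP => // _; rewrite cutoff_le0// s_out. Qed.

Let tau_out x : ~ U x -> tau x = 0.
Proof. by move=> Ux; rewrite /tau patchE; case: ifP => // _; rewrite cutoff'_le0// s_out. Qed.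

Let tau_notin x : ~ H x -> tau x = 0.
Proof. by move=> Hx; rewrite /tau patchE memNset. Qed.

Let w_notin x : ~ H x -> w x = 0.
Proof. by move=> Hx; rewrite /w patchE memNset. Qed.

(** If [rho x] lies in [H], it is outside [U], since otherwise [rho] would send it back to x inside
    [U]. *)
Let wr_out x : ~ U x -> w (r x) = 0 /\ tau (r x) = 0.
Proof.
move=> Ux; have [Hx|Hx] := pselect (H (r x)); last by rewrite w_notin// tau_notin.
have Urx : ~ U (r x).
  by move=> /(rho_rectangle ba) /(_ (ltW Hx)); rewrite rhoK.
by rewrite w_out// tau_out.
Qed.

Let Dw_out x : tau x = 0 -> Dw x = (0, 0).
Proof. by move=> t0; rewrite /Dw t0 !mul0r. Qed.

Let m_s : measurable_fun setT s.
Proof.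
have [[mu_ _ _] _ _] := uA.
by apply: measurable_funB => //; apply: (measurableT_comp mu_); exact: measurable_rho.
Qed.

Let m_patch (h : R * R -> R) : measurable_fun setT h -> measurable_fun setT (h \_ H).
Proof.
move=> mh; have mH := measurable_above a b.
by apply: (measurable_restrictT h mH).1; exact: measurable_funTS.
Qed.

Let m_rho (h : R * R -> R) : measurable_fun setT h -> measurable_fun setT (h \o r).
Proof. by move=> mh; apply: (measurableT_comp mh); exact: measurable_rho. Qed.

Let m_w : measurable_fun setT w.
Proof.
apply: m_patch; apply: (measurableT_comp _ m_s).
by apply: continuous_measurable_fun; exact: continuous_cutoff.
Qed.

Let m_tau : measurable_fun setT tau.
Proof.
apply: m_patch; apply: (measurableT_comp _ m_s).
by apply: continuous_measurable_fun; exact: continuous_cutoff'.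
Qed.

Let m_Dw1 : measurable_fun setT (fun x => (Dw x).1).
Proof.
have [[_ m1 m2] _ _] := uA.
apply: measurable_funM => //; apply: measurable_funB => //; exact: (m_rho m2).
Qed.

Let m_Dw2 : measurable_fun setT (fun x => (Dw x).2).
Proof.
have [[_ m1 m2] _ _] := uA.
apply: measurable_funM => //; apply: measurable_funB => //; exact: (m_rho m1).
Qed.

Let K := chi_const d.
Let K0 : 0 < K. Proof. exact: chi_const_gt0. Qed.

(** Since u >= 0, [chi] leaves u unchanged, so the truncated test functions still approximate u
    itself. *)
Let err_u f x : test_function U f -> err u A (chi d \o f) x <= K * err u A f x.
Proof.
move=> tf; have := err_chi u d0 tf (A1 x).
congr (_ <= _); rewrite /err /= chi_ge0// chi'_ge0// !mul1r//.
Qed.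

(** One factor K comes from [cutoff], the other from [chi], and 2 from the square of a
    difference. *)
Let err_w f x : test_function U f ->
  err w Dw (cut_diff a b d (chi d \o f)) x
  <= 2 * K ^+ 2 * (err u A f x + err u A f (r x)).
Proof.
move=> tf; have tg := chi_test d0 tf; have gd y : - d <= (chi d \o f) y := chi_ge _ d0.
set g := chi d \o f in tg gd *.
have K2 : 0 <= 2 * K ^+ 2 by rewrite mulr_ge0// sqr_ge0.
have E0 y : 0 <= err u A f y by exact: err_ge0.
have [Hx|Hx] := pselect (H x); last first.
  have G0 : cut_diff a b d g x = 0 by rewrite /cut_diff patchE memNset.
  have P1 : pd1 (cut_diff a b d g) x = 0.
    by rewrite (pd1_cut_diff d0 tg) patchE memNset.
  have P2 : pd2 (cut_diff a b d g) x = 0.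
    by rewrite (pd2_cut_diff d0 tg) patchE memNset.
  rewrite /err G0 P1 P2 (w_notin Hx) (Dw_out (tau_notin Hx)) /= !subr0 expr0n/= !addr0.
  by apply: mulr_ge0 K2 _; apply: addr_ge0; exact: E0.
have e1 := err_u x tf; have e2 := err_u (r x) tf.
apply: (@le_trans _ _ (K * (2 * (err u A g x + err u A g (r x))))); last first.
  rewrite expr2 mulrCA -!mulrA; apply: ler_wpM2l => //; apply: ler_wpM2l; first exact: ltW.
  by rewrite mulrDr; exact: lerD.
have GE : cut_diff a b d g x = cutoff d (g x - g (r x)).
  by rewrite /cut_diff patchE mem_set.
have P1 : pd1 (cut_diff a b d g) x =
    cutoff' d (g x - g (r x)) * (pd1 g x - pd2 g (r x)).
  by rewrite (pd1_cut_diff d0 tg) patchE mem_set.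
have P2 : pd2 (cut_diff a b d g) x =
    cutoff' d (g x - g (r x)) * (pd2 g x - pd1 g (r x)).
  rewrite (pd2_cut_diff d0 tg) patchE (mem_set Hx); exact: erefl.
have wE : w x = cutoff d (s x) by rewrite /w patchE mem_set.
have tE : tau x = cutoff' d (s x) by rewrite /tau patchE mem_set.
rewrite /err GE P1 P2 wE /Dw tE /=.
apply: le_trans (trunc_err _ _ _ _ _ _ _) _.
- exact: cutoff_lipschitz.
- exact: trunc'_01.
- exact: cutoff'_lipschitz.
- exact: normrB_le2 (A1 x true) (A1 (r x) false).
- exact: normrB_le2 (A1 x false) (A1 (r x) true).
rewrite -/(chi_const d) -/K; apply: ler_wpM2l; first exact: ltW.
exact: sqr_diff3_le.
Qed.

Let w_H0 : H0 a b w Dw.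
Proof.
apply: (@approx_dom R a b u A w Dw a b (2 * K ^+ 2)) => //.
- by rewrite mulr_gt0// exprn_gt0.
- by move=> x Ux; rewrite w_out// Dw_out// tau_out.
move=> f tf; exists (cut_diff a b d (chi d \o f)).
  by apply: cut_diff_test => //; [exact: chi_test|move=> x; exact: chi_ge].
by move=> x; exact: err_w.
Qed.

Let v_H0 : H0 a b v Dv.
Proof.
have [[mu_ m1 m2] out _] := uA.
apply: (@approx_dom R a b u A v Dv a b (3 * K + 12 * K ^+ 2)) => //.
- by rewrite addr_gt0// mulr_gt0// exprn_gt0.
- split.
  + apply: measurable_funD; first exact: measurable_funB.
    exact: (m_rho m_w).
  + apply: measurable_funD; first exact: measurable_funB.
    exact: (m_rho m_Dw2).
  + apply: measurable_funD; first exact: measurable_funB.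
    exact: (m_rho m_Dw1).
- move=> x Ux; have [ux Ax] := out x Ux; have [wr tr] := wr_out Ux.
  rewrite /v /Dv ux Ax wr w_out// (Dw_out tr) Dw_out ?tau_out//=.
  by rewrite !subr0 !addr0.
move=> f tf.
have tg := chi_test d0 tf; have gd y : - d <= (chi d \o f) y := chi_ge _ d0.
have eu x := err_u x tf; have ew x := err_w x tf.
set g := chi d \o f in tg gd eu ew *.
set G := cut_diff a b d g in ew *.
have tG : test_function U G by exact: cut_diff_test.
have tGr : test_function U (G \o r) by exact: cut_diff_rho_test.
have [_ _ _ dg1 dg2] := test_pd tg.
have [_ _ _ dG1 dG2] := test_pd tG.
have [_ _ _ dr1 dr2] := test_pd tGr.
pose V x := g x - G x + (G \o r) x.
have pV1 x : pd1 V x = pd1 g x - pd1 G x + pd2 G (r x).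
  have E : pd1 (G \o r) x = _ := pd1_cut_diff_rho d0 tg gd x; rewrite -E.
  have dV := is_deriveD (is_deriveB (dg1 x) (dG1 x)) (dr1 x).
  exact: (@is_derive_pd _ true V x _ dV).
have pV2 x : pd2 V x = pd2 g x - pd2 G x + pd1 G (r x).
  have E : pd2 (G \o r) x = _ := pd2_cut_diff_rho d0 tg gd x; rewrite -E.
  have dV := is_deriveD (is_deriveB (dg2 x) (dG2 x)) (dr2 x).
  exact: (@is_derive_pd _ false V x _ dV).
exists V.
  have [_ cK1 KU1] := tg; have [_ cK2 KU2] := tGr.
  apply: (@test_supp _ _ _ (closure [set x | g x != 0] `|` closure [set x | (G \o r) x != 0])).
  - move=> n; apply: SnD; last exact: test_Sn tGr.
    by apply: SnD; [exact: test_Sn tg|apply: SnN; exact: test_Sn tG].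
  - exact: compactU.
  - by apply: closedU; exact: closed_closure.
  - by rewrite subUset.
  - move=> x /not_orP[gx Gx].
    have {}gx : g x = 0.
      by apply/eqP; apply: contra_notT gx => ?; exact: subset_closure.
    have {}Gx : (G \o r) x = 0.
      by apply/eqP; apply: contra_notT Gx => ?; exact: subset_closure.
    have Gx0 : G x = 0 := cut_diff_eq0 a b d0 gd gx.
    by rewrite /V Gx gx Gx0 subr0 addr0.
move=> x.
have H3 : err v Dv V x <= 3 * (err u A g x + err w Dw G x + err w Dw G (r x)).
  rewrite /err pV1 pV2 /v /Dv /V /=.
  exact: sqr_sum33_le.
apply: le_trans H3 _; apply: combine_le (eu x) (ew x) _; first exact: ltW.
  exact: err_ge0.
by have := ew (r x); rewrite rhoK.
Qed.

(** At most one of the two terms is nonzero, because [rho] maps [H] off itself; the sum takes the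
    same value at x and at [rho x]. *)
Let T x := tau x + tau (r x).

Let T01 x : 0 <= T x < 1.
Proof.
have tau01 y : 0 <= tau y < 1.
  rewrite /tau patchE; case: ifP => _; last by rewrite lexx ltr01.
  by rewrite trunc'_ge0 trunc'_lt1.
rewrite /T; have [Hx|Hx] := pselect (H x).
  by rewrite (tau_notin (above_rho Hx)) addr0.
by rewrite (tau_notin Hx) add0r.
Qed.

Let Dv_convex x : Dv x = ((1 - T x) * (A x).1 + T x * (A (r x)).2,
  (1 - T x) * (A x).2 + T x * (A (r x)).1).
Proof. by rewrite /Dv /Dw /T /= rhoK; congr pair; ring. Qed.

Let gamma_Dv x : gamma q (Dv x) <= 1.
Proof.
have /andP[T0 T1] := T01 x; rewrite Dv_convex.
have gAr : gamma q ((A (r x)).2, (A (r x)).1) <= 1.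
  by rewrite gamma_swap -surjective_pairing.
have c01 : 0 <= T x <= 1 by rewrite T0 ltW.
exact: (gamma_convex q1 c01 (gA x) gAr).
Qed.

Let gap x : R := ((A x).1 - (A (r x)).2) ^+ 2 + ((A x).2 - (A (r x)).1) ^+ 2.

(* At x and at its mirror image, Dv is a convex combination of the same two
   vectors with exchanged weights, and the linear terms cancel. *)
Let density_gap x : density eta u A x - density eta v Dv x
    + (density eta u A (r x) - density eta v Dv (r x)) = T x * (1 - T x) * gap x.
Proof.
have Tr : T (r x) = T x by rewrite /T rhoK addrC.
by rewrite /density !Dv_convex /v /gap Tr /= rhoK; field.
Qed.

Hypothesis umin : forall v D, H0 a b v D -> (forall x, gamma q (D x) <= 1) ->
  \int[mu]_x density eta u A x <= \int[mu]_x density eta v D x.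

Lemma reflection_ae : {ae mu, forall x, H x -> U x -> u x - u (r x) <= d}.
Proof.
pose h x := density eta u A x - density eta v Dv x.
have iu := density_integrable eta uA; have iv := density_integrable eta v_H0.
have ih : mu.-integrable setT (EFin \o h) by exact: (integrableB measurableT iu iv).
have hle : \int[mu]_x h x <= 0.
  by rewrite RintegralB// subr_le0; exact: umin.
have ihr := integrable_rho a b ih.
(* The integral of this symmetrized difference is twice the energy drop, and [density_gap] makes it
   nonnegative pointwise. *)
pose k x := h x + h (r x).
have kE x : k x = T x * (1 - T x) * gap x by exact: density_gap.
have ik : mu.-integrable setT (EFin \o k) by exact: (integrableD measurableT ih ihr).
have k0 x : 0 <= k x.
  have /andP[T0 T1] := T01 x; rewrite kE mulr_ge0//; last by rewrite addr_ge0 ?sqr_ge0.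
  by rewrite mulr_ge0// subr_ge0 ltW.
have kle : \int[mu]_x k x <= 0.
  rewrite RintegralD// (integral_rho a b ih).
  by rewrite -[leRHS]addr0; apply: lerD.
have kae := integral_le0_ae ik k0 kle.
(* As T < 1, either the slope is 0 or the gradient agrees with the reflected one. In both cases D_2
   w = 0, and [H0_eq0] concludes from this component alone. *)
have D0 : {ae mu, forall x, (Dw x).2 <= 0}.
  apply: (lebesgue2_ae kae) => x /eqP; rewrite kE.
  have [Hx|Hx] := pselect (H x); last by rewrite Dw_out// tau_notin.
  have TE : T x = tau x by rewrite /T (tau_notin (above_rho Hx)) addr0.
  have /andP[T0 T1] := T01 x.
  rewrite mulf_eq0 mulf_eq0 subr_eq0 [1 == _]gt_eqF// orbF => /orP[t0|].
    by rewrite Dw_out// -TE; exact/eqP.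
  rewrite /gap paddr_eq0 ?sqr_ge0// !sqrf_eq0 => /andP[_ /eqP g0].
  by rewrite /Dw g0 mulr0.
have w0 : {ae mu, forall x, w x = 0}.
  apply: (H0_eq0 a0 b0 w_H0) D0 => x; rewrite /w patchE; case: ifP => // _.
  exact: trunc_ge0.
apply: (lebesgue2_ae w0) => x + Hx _; rewrite /w patchE mem_set// => /cutoff_eq0.
exact.
Qed.

End reflection_inequality.

(** * Distance to the boundary *)

Section distance_to_boundary.
Variables (R : realType) (a b p : R).
Hypotheses (a0 : 0 < a) (b0 : 0 < b) (p0 : 0 < p).
Local Notation U := (rectangle a b).
Implicit Types x y z : R * R.

Lemma gamma_ge1 x : `|x.1| <= gamma p x.
Proof.
have E : (`|x.1| `^ p) `^ p^-1 = `|x.1|.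
  by rewrite -powRrM mulfV ?gt_eqF// powRr1.
rewrite -[leLHS]E; apply: ge0_ler_powR; rewrite ?nnegrE ?addr_ge0 ?powR_ge0//.
  by rewrite invr_ge0 ltW.
by rewrite lerDl powR_ge0.
Qed.

Lemma gamma_swap_pair x : gamma p (x.2, x.1) = gamma p x.
Proof. by rewrite /gamma/= addrC. Qed.

Lemma gamma_ge2 x : `|x.2| <= gamma p x.
Proof. by rewrite -gamma_swap_pair; exact: (gamma_ge1 (x.2, x.1)). Qed.

Lemma gamma_axis1 x : x.2 = 0 -> gamma p x = `|x.1|.
Proof.
move=> x2; rewrite /gamma x2 normr0 (powR0 (lt0r_neq0 p0)) addr0.
by rewrite -powRrM mulfV ?gt_eqF// powRr1.
Qed.

Lemma gamma_axis2 x : x.1 = 0 -> gamma p x = `|x.2|.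
Proof. by move=> x1; rewrite -gamma_swap_pair gamma_axis1. Qed.

Lemma dist_boundary_le x y : boundary U y -> dist_boundary p U x <= gamma p (x - y).
Proof.
move=> Uy; apply: ge_inf; last by exists y.
by exists 0 => _ [z _ <-]; exact: powR_ge0.
Qed.

Lemma le_dist_boundary x (m : R) : boundary U !=set0 ->
  (forall y, boundary U y -> m <= gamma p (x - y)) -> m <= dist_boundary p U x.
Proof.
move=> [y Uy] H; apply: lb_le_inf; first by exists (gamma p (x - y)); exists y.
by move=> _ [z Uz <-]; exact: H.
Qed.

Lemma boundary_notin y : boundary U y -> a <= `|y.1| \/ b <= `|y.2|.
Proof.
move=> [_]; rewrite (interior_id _).1; last exact: open_rectangle.
rewrite /rectangle/= => /not_andP[] /negP; rewrite -leNgt; by [left|right].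
Qed.

Lemma boundary_approach y (e : R * R) (c : R) : 0 < c -> ~ U y ->
  (forall t, 0 < t < c -> U (y + t *: e)) -> boundary U y.
Proof.
move=> c0 Uy Ut; split; last by move=> /interior_subset.
move=> B nB.
have ct : y + t *: e @[t --> (0 : R)] --> y.
  have E : y = y + (0 : R) *: e by rewrite scale0r addr0.
  rewrite [X in _ --> X]E; apply: cvgD; first exact: cvg_cst.
  exact: scalel_continuous.
have n1 : \forall t \near (0 : R)^'+, B (y + t *: e).
  by apply: cvg_within; exact: (ct _ nB).
have n2 : \forall t \near (0 : R)^'+, 0 < t < c.
  by near=> t; apply/andP; split.
have [t [Bt tc]] := filter_ex (filterI n1 n2).
by exists (y + t *: e); split => //; exact: Ut.
Unshelve. all: by end_near.
Qed.

Lemma boundary_bottom (s : R) : `|s| < a -> boundary U (s, - b).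
Proof.
move=> sa; apply: (@boundary_approach _ (0, 1) (2 * b)).
- by rewrite mulr_gt0.
- by move=> [_ /=]; rewrite normrN gtr0_norm// ltxx.
- move=> t tb; split => /=.
    by rewrite scaler0 addr0.
  by rewrite /GRing.scale/= mulr1 ltr_norml; move: b0 tb; lra.
Qed.

Lemma boundary_top (s : R) : `|s| < a -> boundary U (s, b).
Proof.
move=> sa; apply: (@boundary_approach _ (0, - 1) (2 * b)).
- by rewrite mulr_gt0.
- by move=> [_ /=]; rewrite gtr0_norm// ltxx.
- move=> t tb; split => /=.
    by rewrite scaler0 addr0.
  by rewrite /GRing.scale/= mulrN1 ltr_norml; move: b0 tb; lra.
Qed.

Lemma boundary_left (s : R) : `|s| < b -> boundary U (- a, s).
Proof.
move=> sb; apply: (@boundary_approach _ (1, 0) (2 * a)).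
- by rewrite mulr_gt0.
- by move=> [/=]; rewrite normrN gtr0_norm// ltxx.
- move=> t ta; split => /=; last by rewrite scaler0 addr0.
  by rewrite /GRing.scale/= mulr1 ltr_norml; move: a0 ta; lra.
Qed.

End distance_to_boundary.

(** * The reflected point and the inclusion *)

(** Put m = x_1 + a. From rho x the bottom side is at distance m, the left one at b + x_2 >= m, the
    top one at 2 b - m >= m because m <= b, and the right one at 2 a - b - x_2 >= b - x_2 >= m. *)
Lemma reflected_gap (R : realDomainType) (a b x1 x2 t1 t2 : R) :
  b <= a -> x1 + a <= b + x2 -> x1 + a <= b - x2 -> a <= `|t1| \/ b <= `|t2| ->
  x1 + a <= `|x2 - a + b - t1| \/ x1 + a <= `|x1 + a - b - t2|.
Proof.
move=> ba mb mt; case; rewrite ler_normr => /orP[ht|ht]; [left|left|right|right].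
- by rewrite distrC; apply: le_trans (ler_norm _); lra.
- by apply: le_trans (ler_norm _); lra.
- by rewrite distrC; apply: le_trans (ler_norm _); lra.
- by apply: le_trans (ler_norm _); lra.
Qed.

Lemma rho_bisector (R : realType) (a b x1 x2 : R) :
  x2 - x1 <= a - b -> x1 + a <= b + x2 -> rho a b (x1, x2) = (x1, x2).
Proof. by move=> h1 h2; rewrite /rho/=; congr pair; lra. Qed.

Lemma ae_le_everywhere (R : realType) (A : set (R * R)) (f : R * R -> R) (c : R) : open A ->
  (forall x, A x -> {for x, continuous f}) ->
  {ae @lebesgue2 R, forall x, A x -> f x <= c} -> forall x, A x -> f x <= c.
Proof.
move=> oA cf H; apply: (@ae_open _ A (fun x => f x <= c)) => //.
rewrite openE => x [Ax /= /negP]; rewrite -ltNge => fx.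
have n1 : \forall y \near x, A y by apply: open_nbhs_nbhs.
have n2 : \forall y \near x, c < f y by exact: (cf x Ax _ (lt_nbhsr fx)).
apply: filterS2 n1 n2 => y Ay fy; split => //= fc.
by move: fy; rewrite ltNge fc.
Qed.

(** This is the inclusion before closures are taken. The integral arguments give bounds almost
    everywhere; continuity of u extends them to all points concerned, and the slack d is
    arbitrary. *)
Lemma reflected_left_side_plastic (R : realType) (q p eta a b : R) (u : R * R -> R)
    (hq1 : 1 < q) (p0 : 0 < p) (heta : 0 < eta)
    (ha : 0 < a) (hb : 0 < b) (hba : b < a)
    (hu : minimizer q eta (rectangle a b) u)
    (hcont : {within rectangle a b, continuous u}) (x y : R * R) :
  plastic p (rectangle a b) u x -> left_side a b y ->
  closest_point p (rectangle a b) x y ->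
  plastic p (rectangle a b) u (rho a b x) /\
  exists2 z, bottom_side a b z & closest_point p (rectangle a b) (rho a b x) z.
Proof.
set U := rectangle a b.
have oU : open U := @open_rectangle R a b.
have cu z : U z -> {for z, continuous u}.
  by move=> Uz; move: hcont; rewrite continuous_open_subspace// => /(_ z); apply; exact/mem_set.
have [A [uA gA umin]] := minimizer_normal_form ha hb hq1 hu.
have uE z : U z -> (u \_ U) z = u z by move=> Uz; rewrite patchE mem_set.
have u0 z : U z -> - u z <= 0.
  move: z; apply: (@ae_le_everywhere R U (fun z => - u z) 0 oU) => [t Ut|].
    by apply: cvgN; exact: cu.
  apply: (lebesgue2_ae (minimizer_ge0 hq1 heta uA gA umin)) => t + Ut.
  by rewrite uE// oppr_le0.
have u0' z : 0 <= (u \_ U) z.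
  rewrite patchE; case: ifPn => // /set_mem Uz.
  by have := u0 z Uz; rewrite oppr_le0.
have ub z : U z -> u z - (z.2 + b) <= 0.
  move=> Uz; apply/ler_addgt0Pr => d d0; rewrite add0r; move: z Uz.
  apply: (@ae_le_everywhere R U (fun z => u z - (z.2 + b)) d oU) => [t Ut|].
    apply: cvgB; first exact: cu.
    by apply: cvgD; [exact: cvg_snd|exact: cvg_cst].
  have A1 i z : `|coord i (A z)| <= 1 by exact: gamma_coord_le1 (gA z).
  apply: (lebesgue2_ae (H0_upper ha hb d0 uA A1)) => t + Ut => /(_ Ut).
  by rewrite uE//; lra.
have ur z : U z -> a - b < z.2 - z.1 -> u z - u (rho a b z) <= 0.
  move=> Uz Hz; apply/ler_addgt0Pr => d d0; rewrite add0r.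
  have : (U `&` above a b) z by [].
  move: z {Uz Hz}; apply: (@ae_le_everywhere R _ (fun z => u z - u (rho a b z)) d).
  - by apply: openI => //; exact: open_above.
  - move=> t [Ut Ht]; apply: cvgB; first exact: cu.
    apply: continuous_comp; first exact: rho_continuous.
    by apply: cu; apply: rho_rectangle => //; exact: ltW.
  - apply: (lebesgue2_ae (reflection_ae ha hb hba hq1 d0 uA gA u0' umin)) => t + [Ut Ht].
    move=> /(_ Ht Ut); rewrite !uE//.
    by apply: rho_rectangle => //; exact: ltW.
case: x => x1 x2 [Ux ux] [y1 y2b] [By dy].
have [/= xa xb] := Ux.
move: (xa) (xb); rewrite !ltr_norml => /andP[xa1 xa2] /andP[xb1 xb2].
set m := x1 + a.
have m0 : 0 < m by rewrite /m; lra.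
(* At most m, by the point of the left side at the same height; at least m, because the closest
   point lies on that side and [gamma p] dominates the first coordinate. *)
have dx : dist_boundary p U (x1, x2) = m.
  apply/eqP; rewrite eq_le; apply/andP; split.
    apply: le_trans (dist_boundary_le p _ (boundary_left ha xb)) _.
    by rewrite gamma_axis1//= ?subrr// opprK gtr0_norm.
  rewrite -dy; apply: le_trans (gamma_ge1 p0 _).
  by rewrite /= y1 opprK ler_norm.
have mb : m <= b + x2.
  rewrite -dx; apply: le_trans (dist_boundary_le p _ (boundary_bottom hb xa)) _.
  rewrite gamma_axis2//= ?subrr// opprK gtr0_norm; lra.
have mt : m <= b - x2.
  rewrite -dx; apply: le_trans (dist_boundary_le p _ (boundary_top hb xa)) _.
  rewrite gamma_axis2//= ?subrr// ltr0_norm; lra.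
have hba' := hba.
have Urx : U (rho a b (x1, x2)) by apply: rho_rectangle => //=; move: mb; rewrite /m; lra.
have [/= ra rb] := Urx.
have Bz := boundary_bottom hb ra.
have gz : gamma p (rho a b (x1, x2) - ((rho a b (x1, x2)).1, - b)) = m.
  by rewrite gamma_axis2//= ?subrr// opprK subrK gtr0_norm.
have drx : dist_boundary p U (rho a b (x1, x2)) = m.
  apply/eqP; rewrite eq_le; apply/andP; split.
    by rewrite -gz; exact: dist_boundary_le.
  apply: le_dist_boundary; first by exists ((rho a b (x1, x2)).1, - b).
  move=> t Ut.
  case: (reflected_gap (ltW hba) mb mt (boundary_notin Ut)) => mz.
    exact: (le_trans mz (gamma_ge1 p0 (rho a b (x1, x2) - t))).
  exact: (le_trans mz (gamma_ge2 p0 (rho a b (x1, x2) - t))).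
split.
  split; [exact: Urx|rewrite drx; apply/eqP; rewrite eq_le; apply/andP; split].
    have ubx : u (rho a b (x1, x2)) - (x1 + a - b + b) <= 0 := ub _ Urx.
    by move: ubx; rewrite subrK subr_le0.
  rewrite -dx -ux; have [hx|hx] := ltP (a - b) (x2 - x1).
    by have := ur _ Ux hx; rewrite subr_le0.
  (* Off the open half plane, m <= b + x_2 forces x onto the bisector, which [rho] fixes. *)
  have -> : rho a b (x1, x2) = (x1, x2); last exact: lexx.
  exact: rho_bisector.
exists ((rho a b (x1, x2)).1, - b).
  exact: (conj (ltW ra) erefl).
by split; [exact: Bz|rewrite drx].
Qed.

Unset Implicit Arguments.

Theorem theorem6 (R : realType) (q p eta a b : R) (u : R * R -> R)
    (hq1 : 1 < q) (hq2 : q <= 2) (hp : p = q / (q - 1)) (heta : 0 < eta)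
    (ha : 0 < a) (hb : 0 < b)
    (hu : minimizer q eta (rectangle a b) u)
    (hcont : {within rectangle a b, continuous u})
    (hba : b < a) :
  rho a b @` plastic_component p (rectangle a b) u (left_side a b)
    `<=` plastic_component p (rectangle a b) u (bottom_side a b).
Proof.
have p0 : 0 < p by rewrite hp divr_gt0 ?subr_gt0// (lt_trans ltr01).
move=> _ [x clx <-] B nB.
(* By continuity of [rho] the preimage of [B] is a neighbourhood of x, so it meets the set whose
   closure is the left component. *)
have [y [[py [z lz cz]] By]] := clx _ (@rho_continuous R a b x _ nB).
exists (rho a b y); split; last exact: By.
exact (reflected_left_side_plastic hq1 p0 heta ha hb hba hu hcont py lz cz).
Qed.
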